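(* Let $\mathcal H_{1\rm S}^{\rm cop}$ be the (co-opposite) Schwarzian Hopf algebra and let $M_\delta$ be the four dimensional vector space with basis $\mathbf 1,\mathbf R^X,\mathbf R^Y,\mathbf R^Z$. The right action determined by $$\mathbf 1\cdot X=0,\quad \mathbf 1\cdot Y=\mathbf 1,\quad \mathbf 1\cdot\delta_1=\mathbf R^Z,$$ $$\mathbf R^X\cdot X=-\mathbf R^Y,\quad \mathbf R^X\cdot Y=2\mathbf R^X,\quad \mathbf R^X\cdot\delta_1=0,$$ $$\mathbf R^Y\cdot X=-\mathbf R^Z,\quad \mathbf R^Y\cdot Y=\mathbf R^Y,\quad \mathbf R^Y\cdot\delta_1=0,$$ $$\mathbf R^Z\cdot X=0,\quad \mathbf R^Z\cdot Y=0,\quad \mathbf R^Z\cdot\delta_1=0,$$ and the left coaction $M_\delta\to\mathcal H_{1\rm S}^{\rm cop}\otimes M_\delta$ given by $$\mathbf 1\mapsto1\otimes\mathbf 1+X\otimes\mathbf R^X+Y\otimes\mathbf R^Y,\qquad \mathbf R^X\mapsto1\otimes\mathbf R^X,$$ $$\mathbf R^Y\mapsto1\otimes\mathbf R^Y+\delta_1\otimes\mathbf R^X,\qquad \mathbf R^Z\mapsto1\otimes\mathbf R^Z+\delta_1\otimes\mathbf R^Y+\tfrac12\delta_1^2\otimes\mathbf R^X$$ make $M_\delta$ an SAYD module over $\mathcal H_{1\rm S}^{\rm cop}$.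
   Context: Over $\mathbb C$. $\mathcal H_{1\rm S}^{\rm cop}$ is the Hopf algebra generated as an algebra by $X,Y,\delta_1$ with relations $[Y,X]=X$, $[X,\delta_1]=\frac12\delta_1^2$, $[Y,\delta_1]=\delta_1$, with $Y,\delta_1$ primitive, $\Delta(X)=X\otimes1+1\otimes X+Y\otimes\delta_1$, $\varepsilon(X)=\varepsilon(Y)=\varepsilon(\delta_1)=0$. (It is the bicrossed product of $\mathbb C[\delta_1]$ and $U(\mathfrak{gl}_1^{\rm aff})$, $\mathfrak{gl}_1^{\rm aff}=\langle X,Y\rangle$.) A right-left SAYD module over a Hopf algebra $H$ is a right $H$-module and left $H$-comodule $M$, $m\mapsto m_{\{-1\}}\otimes m_{\{0\}}$, such that $(m\cdot h)_{\{-1\}}\otimes(m\cdot h)_{\{0\}}=S(h_{(3)})m_{\{-1\}}h_{(1)}\otimes m_{\{0\}}\cdot h_{(2)}$ and $m_{\{0\}}\cdot m_{\{-1\}}=m$ for all $m\in M$, $h\in H$. In the paper $M_\delta=M\otimes\mathbb C_\delta$ with $M=\mathbb C\langle1_M,R^X,R^Y,R^Z\rangle$ the truncated symmetric algebra $S(sl_2^* )_{[2]}$ and $\delta(X)=0,\ \delta(Y)=1,\ \delta(\delta_1)=0$. *)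

(* Defs.v *)
From HB Require Import structures.
From mathcomp Require Import all_boot all_order all_algebra.
From mathcomp Require Import boolp reals complex.

Set Implicit Arguments.
Unset Strict Implicit.
Unset Printing Implicit Defensive.

Import GRing.Theory Num.Theory.
Local Open Scope ring_scope.
Local Open Scope quotient_scope.

Definition bilin (K : comNzRingType) (U V W : lmodType K) (f : U -> V -> W) :=
  (forall v, linear (f^~ v)) /\ (forall u, linear (f u)).

(* The tensor product V (x) W over K: finite formal sums
   v_1 (x) w_1 + ... + v_n (x) w_n, modulo the smallest congruence that makes
   (x) bilinear. *)
Section TensorType.
Variables (K : comNzRingType) (V W : lmodType K).

Inductive tensor_eq : seq (V * W) -> seq (V * W) -> Prop :=
| tensor_refl s : tensor_eq s s
| tensor_sym s t : tensor_eq s t -> tensor_eq t s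
| tensor_trans s t u : tensor_eq s t -> tensor_eq t u -> tensor_eq s u
| tensor_cat s s' t t' :
    tensor_eq s s' -> tensor_eq t t' -> tensor_eq (s ++ t) (s' ++ t')
| tensor_comm s t : tensor_eq (s ++ t) (t ++ s)
| tensor_zero w : tensor_eq [:: (0, w)] [::]
| tensor_addl v v' w : tensor_eq [:: (v + v', w)] [:: (v, w); (v', w)]
| tensor_addr v w w' : tensor_eq [:: (v, w + w')] [:: (v, w); (v, w')]
| tensor_scale a v w : tensor_eq [:: (a *: v, w)] [:: (v, a *: w)].

Definition tensor_rel : rel (seq (V * W)) := fun s t => `[< tensor_eq s t >].

Fact tensor_rel_refl : reflexive tensor_rel.
Proof. by move=> s; apply/asboolP; constructor. Qed.
Fact tensor_rel_sym : symmetric tensor_rel.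
Proof. by move=> s t; apply/asboolP/asboolP; apply: tensor_sym. Qed.
Fact tensor_rel_trans : transitive tensor_rel.
Proof.
by move=> t s u /asboolP st /asboolP tu; apply/asboolP; apply: tensor_trans tu.
Qed.

Canonical tensor_equiv :=
  EquivRel tensor_rel tensor_rel_refl tensor_rel_sym tensor_rel_trans.

Definition tensor : Type := {eq_quot tensor_rel}.
HB.instance Definition _ := Choice.on tensor.

Definition tclass (s : seq (V * W)) : tensor := \pi_({eq_quot tensor_rel}) s.
Definition trepr (t : tensor) : seq (V * W) := repr (t : {eq_quot tensor_rel}).

Lemma treprK t : tclass (trepr t) = t.
Proof. exact: reprK. Qed.

Lemma tclassP s t : tclass s = tclass t <-> tensor_eq s t.
Proof. by split=> [/eqquotP/asboolP//|st]; apply/eqquotP/asboolP. Qed.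

Lemma trepr_class s : tensor_eq (trepr (tclass s)) s.
Proof. by apply/tclassP; rewrite treprK. Qed.

Definition tscale_seq (a : K) (s : seq (V * W)) := [seq (a *: p.1, p.2) | p <- s].

Definition tadd (s t : tensor) := tclass (trepr s ++ trepr t).
Definition tscale a (t : tensor) := tclass (tscale_seq a (trepr t)).
Definition topp (t : tensor) := tscale (-1) t.

Lemma tscale_seq_eq a s t :
  tensor_eq s t -> tensor_eq (tscale_seq a s) (tscale_seq a t).
Proof.
elim=> {s t} [s|s t _ ih|s t u _ ih1 _ ih2|s s' t t' _ ih1 _ ih2|s t|w|v v' w|v w w'|b v w].
- exact: tensor_refl.
- exact: tensor_sym.
- exact: tensor_trans ih2.
- by rewrite /tscale_seq !map_cat; apply: tensor_cat.
- by rewrite /tscale_seq !map_cat; apply: tensor_comm.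
- by rewrite /= scaler0; apply: tensor_zero.
- by rewrite /= scalerDr; apply: tensor_addl.
- exact: tensor_addr.
- rewrite /= scalerA mulrC -scalerA; exact: tensor_scale.
Qed.

Lemma tadd_class s t : tadd (tclass s) (tclass t) = tclass (s ++ t).
Proof. by apply/tclassP/tensor_cat; apply: trepr_class. Qed.
Lemma tscale_class a s : tscale a (tclass s) = tclass (tscale_seq a s).
Proof. by apply/tclassP/tscale_seq_eq/trepr_class. Qed.

Fact taddA : associative tadd.
Proof.
move=> r s t; rewrite -[r]treprK -[s]treprK -[t]treprK.
by rewrite !tadd_class catA.
Qed.
Fact taddC : commutative tadd.
Proof.
move=> s t; rewrite -[s]treprK -[t]treprK !tadd_class.
exact/tclassP/tensor_comm.
Qed.
Fact tadd0 : left_id (tclass [::]) tadd.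
Proof. by move=> t; rewrite -[t]treprK tadd_class. Qed.

Lemma tscale_seqD a b s :
  tensor_eq (tscale_seq (a + b) s) (tscale_seq a s ++ tscale_seq b s).
Proof.
elim: s => [|[v w] s ih]; first exact: tensor_refl.
have -> : tscale_seq (a + b) ((v, w) :: s) =
    [:: (a *: v + b *: v, w)] ++ tscale_seq (a + b) s by rewrite /= scalerDl.
have -> : tscale_seq a ((v, w) :: s) ++ tscale_seq b ((v, w) :: s) =
    [:: (a *: v, w)] ++ ((tscale_seq a s ++ [:: (b *: v, w)]) ++ tscale_seq b s).
  by rewrite -!catA.
apply: tensor_trans (tensor_cat (tensor_addl _ _ _) ih) _.
rewrite (_ : [:: (a *: v, w); (b *: v, w)] =
    [:: (a *: v, w)] ++ [:: (b *: v, w)]) // -!catA.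
apply: tensor_cat; first exact: tensor_refl.
rewrite !catA; apply: tensor_cat; [exact: tensor_comm | exact: tensor_refl].
Qed.

Lemma tscale_seq0 s : tensor_eq (tscale_seq 0 s) [::].
Proof.
elim: s => [|p s ih]; first exact: tensor_refl.
rewrite -cat1s /tscale_seq map_cat /= scale0r.
exact: tensor_cat (tensor_zero _) ih.
Qed.

Fact taddN : left_inverse (tclass [::]) topp tadd.
Proof.
move=> t; rewrite -[t]treprK /topp tscale_class tadd_class; apply/tclassP.
have e : trepr t = tscale_seq 1 (trepr t).
  by rewrite /tscale_seq map_id_in // => -[v w] _ /=; rewrite scale1r.
rewrite {2}e; apply: (tensor_trans (tensor_sym (tscale_seqD _ _ _))).
by rewrite addNr; apply: tscale_seq0.
Qed.

HB.instance Definition _ := GRing.isZmodule.Build tensor taddA taddC tadd0 taddN.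

Lemma taddE (s t : tensor) : s + t = tadd s t. Proof. by []. Qed.

Fact tscaleA a b t : tscale a (tscale b t) = tscale (a * b) t.
Proof.
rewrite -[t]treprK !tscale_class; congr tclass.
rewrite /tscale_seq -map_comp; apply: eq_map => p /=.
by rewrite scalerA.
Qed.
Fact tscale1 : left_id 1 tscale.
Proof.
move=> t; rewrite -[t]treprK tscale_class; congr tclass.
by apply: map_id_in => -[v w] _ /=; rewrite scale1r.
Qed.
Fact tscaleDr : right_distributive tscale +%R.
Proof.
move=> a s t; rewrite -[s]treprK -[t]treprK [_ + _ in LHS]taddE [RHS]taddE.
by rewrite tadd_class !tscale_class tadd_class /tscale_seq map_cat.
Qed.
Fact tscaleDl t : {morph tscale^~ t : a b / a + b}.
Proof.
move=> a b; rewrite -[t]treprK [RHS]taddE !tscale_class tadd_class.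
exact/tclassP/tscale_seqD.
Qed.

HB.instance Definition _ :=
  GRing.Zmodule_isLmodule.Build K tensor tscaleA tscale1 tscaleDr tscaleDl.

Lemma tscaleE a (t : tensor) : a *: t = tscale a t. Proof. by []. Qed.

Definition pure (v : V) (w : W) : tensor := tclass [:: (v, w)].

(* Sweedler notation: writing t as a sum of v_i (x) w_i, this is the sum of the
   f v_i w_i. The representative of t is a fixed but arbitrary one, so the
   result is meaningful only for bilinear f, see [tsum_class]. *)
Definition tsum (U : lmodType K) (t : tensor) (f : V -> W -> U) : U :=
  \sum_(p <- trepr t) f p.1 p.2.

End TensorType.

Notation "v ⊗ w" := (pure v w) (at level 40, left associativity) : ring_scope.
Notation "\sum[ v ⊗ w <- t ] E" := (tsum t (fun v w => E))
  (at level 41, v name, w name, t at level 60, E at level 41,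
   format "\sum[ v  ⊗  w  <-  t ]  E") : ring_scope.

Section TensorTheory.
Variables (K : comNzRingType).
Implicit Types U V W : lmodType K.

Lemma linear_sum U V (f : U -> V) (I : Type) (s : seq I) (F : I -> U) :
  linear f -> f (\sum_(i <- s) F i) = \sum_(i <- s) f (F i).
Proof.
move=> lf.
have f0 : f 0 = 0.
  have := lf 0 0 0; rewrite !scale0r !add0r => e.
  by apply: (@addrI _ (f 0)); rewrite addr0; have := lf 1 0 0; rewrite !scale1r addr0.
have fD u v : f (u + v) = f u + f v by have := lf 1 u v; rewrite !scale1r.
by elim: s => [|i s ih]; rewrite ?big_nil // !big_cons fD ih.
Qed.

Lemma linear0' U V (f : U -> V) : linear f -> f 0 = 0.
Proof. by move=> lf; have := @linear_sum U V f unit [::] (fun=> 0) lf; rewrite !big_nil. Qed.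
Lemma linearD' U V (f : U -> V) u v : linear f -> f (u + v) = f u + f v.
Proof. by move=> lf; have := lf 1 u v; rewrite !scale1r. Qed.
Lemma linearZ' U V (f : U -> V) a u : linear f -> f (a *: u) = a *: f u.
Proof. by move=> lf; have := lf a u 0; rewrite !addr0 (linear0' lf) addr0. Qed.

Lemma tsum_class V W U (f : V -> W -> U) s :
  bilin f -> tsum (tclass s) f = \sum_(p <- s) f p.1 p.2.
Proof.
case=> f1 f2; rewrite /tsum; move: (trepr _) (trepr_class s) => r.
elim=> {r s} [//|s t _ -> //|r s t _ -> _ -> //|r r' s s' _ ih1 _ ih2|s t|w|v v' w|v w w'|a v w].
- by rewrite !big_cat ih1 ih2.
- by rewrite !big_cat /= addrC.
- by rewrite big_cons !big_nil (linear0' (f1 w)) addr0.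
- by rewrite !big_cons !big_nil !addr0 (linearD' _ _ (f1 w)).
- by rewrite !big_cons !big_nil !addr0 (linearD' _ _ (f2 v)).
- by rewrite !big_cons !big_nil !addr0 (linearZ' _ _ (f1 w)) (linearZ' _ _ (f2 v)).
Qed.

Lemma tsum_pure V W U (f : V -> W -> U) v w : bilin f -> tsum (v ⊗ w) f = f v w.
Proof. by move=> bf; rewrite tsum_class // big_cons big_nil addr0. Qed.

Lemma tsum_linear V W U (f : V -> W -> U) : bilin f -> linear (fun t => tsum t f).
Proof.
move=> bf a s t; rewrite -[s]treprK -[t]treprK.
rewrite taddE tscaleE tscale_class tadd_class !tsum_class //.
rewrite big_cat /= scaler_sumr big_map /=; congr (_ + _).
by apply: eq_bigr => p _; rewrite (linearZ' _ _ (bf.1 p.2)).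
Qed.

Lemma pure_bilin V W : bilin (@pure K V W).
Proof.
split=> [w|v] a x y; rewrite [RHS]taddE tscaleE tscale_class tadd_class;
  apply/tclassP => /=.
  exact: tensor_addl.
apply: tensor_trans (tensor_addr _ _ _) _.
rewrite -[[:: (v, a *: x); _]]cat1s -[[:: (a *: v, _); _]]cat1s.
exact: tensor_cat (tensor_sym (tensor_scale _ _ _)) (tensor_refl _).
Qed.

Lemma eq_tsum V W U (f g : V -> W -> U) t : f =2 g -> tsum t f = tsum t g.
Proof. by move=> fg; apply: eq_bigr => p _; apply: fg. Qed.

Lemma lin_tsum V W U U' (g : U -> U') (f : V -> W -> U) t :
  linear g -> g (tsum t f) = \sum[v ⊗ w <- t] g (f v w).
Proof. exact: linear_sum. Qed.

Lemma tsum_comb V W U (f g : V -> W -> U) a t :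
  \sum[v ⊗ w <- t] (a *: f v w + g v w) = a *: tsum t f + tsum t g.
Proof. by rewrite /tsum big_split /= scaler_sumr. Qed.

Lemma tsum_id V W (t : tensor V W) : \sum[v ⊗ w <- t] v ⊗ w = t.
Proof.
rewrite -{2}[t]treprK /tsum; elim: (trepr t) => [|p s ih]; first by rewrite big_nil.
by rewrite big_cons ih taddE tadd_class; case: p.
Qed.

Lemma tensor_ext V W U (f g : tensor V W -> U) : linear f -> linear g ->
  (forall v w, f (v ⊗ w) = g (v ⊗ w)) -> f =1 g.
Proof.
by move=> lf lg fg t; rewrite -[t]tsum_id !lin_tsum //; apply: eq_tsum.
Qed.

End TensorTheory.

(* K-algebra structures and morphisms given by bare operations, so that they also
   apply to A (x) A, which need not be an [algType] (it could be zero). *)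
Record is_alg (K : comNzRingType) (A : lmodType K) (one : A) (mul : A -> A -> A) :
  Prop := IsAlg {
  is_algA : associative mul;
  is_alg1l : left_id one mul;
  is_alg1r : right_id one mul;
  is_alg_bilin : bilin mul
}.

Record is_alg_hom (K : comNzRingType) (A B : lmodType K)
    (oneA : A) (mulA : A -> A -> A) (oneB : B) (mulB : B -> B -> B) (f : A -> B) :
  Prop := IsAlgHom {
  is_alg_hom_linear : linear f;
  is_alg_hom1 : f oneA = oneB;
  is_alg_homM : {morph f : x y / mulA x y >-> mulB x y}
}.

(* The K-algebra generated by G subject to the relations rels: expressions in the
   generators, modulo the smallest congruence that contains rels and satisfies the
   axioms of a K-algebra. *)
Section Presentation.
Variables (K : comNzRingType) (G : Type).

Inductive nc_term :=
| NGen of G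
| NCst of K
| NAdd of nc_term & nc_term
| NMul of nc_term & nc_term.

HB.instance Definition _ := gen_eqMixin nc_term.
HB.instance Definition _ := gen_choiceMixin nc_term.

Definition NComm s t := NAdd (NMul s t) (NMul (NCst (-1)) (NMul t s)).

Variable rels : nc_term -> nc_term -> Prop.

Inductive palg_eq : nc_term -> nc_term -> Prop :=
| palg_rel s t : rels s t -> palg_eq s t
| palg_refl s : palg_eq s s
| palg_sym s t : palg_eq s t -> palg_eq t s
| palg_trans s t u : palg_eq s t -> palg_eq t u -> palg_eq s u
| palg_add s s' t t' : palg_eq s s' -> palg_eq t t' -> palg_eq (NAdd s t) (NAdd s' t')
| palg_mul s s' t t' : palg_eq s s' -> palg_eq t t' -> palg_eq (NMul s t) (NMul s' t')
| palg_addA s t u : palg_eq (NAdd s (NAdd t u)) (NAdd (NAdd s t) u)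
| palg_addC s t : palg_eq (NAdd s t) (NAdd t s)
| palg_add0 s : palg_eq (NAdd (NCst 0) s) s
| palg_addN s : palg_eq (NAdd (NMul (NCst (-1)) s) s) (NCst 0)
| palg_mulA s t u : palg_eq (NMul s (NMul t u)) (NMul (NMul s t) u)
| palg_mul1 s : palg_eq (NMul (NCst 1) s) s
| palg_mulDl s t u : palg_eq (NMul (NAdd s t) u) (NAdd (NMul s u) (NMul t u))
| palg_mulDr s t u : palg_eq (NMul s (NAdd t u)) (NAdd (NMul s t) (NMul s u))
| palg_cstD a b : palg_eq (NCst (a + b)) (NAdd (NCst a) (NCst b))
| palg_cstM a b : palg_eq (NCst (a * b)) (NMul (NCst a) (NCst b))
| palg_cstC a s : palg_eq (NMul (NCst a) s) (NMul s (NCst a)).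

Definition palg_erel : rel nc_term := fun s t => `[< palg_eq s t >].

Fact palg_erel_refl : reflexive palg_erel.
Proof. by move=> s; apply/asboolP; apply: palg_refl. Qed.
Fact palg_erel_sym : symmetric palg_erel.
Proof. by move=> s t; apply/asboolP/asboolP; apply: palg_sym. Qed.
Fact palg_erel_trans : transitive palg_erel.
Proof.
by move=> t s u /asboolP st /asboolP tu; apply/asboolP; apply: palg_trans tu.
Qed.

Canonical palg_equiv :=
  EquivRel palg_erel palg_erel_refl palg_erel_sym palg_erel_trans.

Definition palg : Type := {eq_quot palg_erel}.
HB.instance Definition _ := Choice.on palg.

Definition pclass (s : nc_term) : palg := \pi_({eq_quot palg_erel}) s.
Definition prepr (t : palg) : nc_term := repr (t : {eq_quot palg_erel}).

Lemma preprK t : pclass (prepr t) = t. Proof. exact: reprK. Qed.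
Lemma pclassP s t : pclass s = pclass t <-> palg_eq s t.
Proof. by split=> [/eqquotP/asboolP//|st]; apply/eqquotP/asboolP. Qed.
Lemma prepr_class s : palg_eq (prepr (pclass s)) s.
Proof. by apply/pclassP; rewrite preprK. Qed.

Definition padd s t := pclass (NAdd (prepr s) (prepr t)).
Definition pmul s t := pclass (NMul (prepr s) (prepr t)).
Definition pcst a := pclass (NCst a).

Lemma padd_class s t : padd (pclass s) (pclass t) = pclass (NAdd s t).
Proof. by apply/pclassP/palg_add; apply: prepr_class. Qed.
Lemma pmul_class s t : pmul (pclass s) (pclass t) = pclass (NMul s t).
Proof. by apply/pclassP/palg_mul; apply: prepr_class. Qed.

Fact paddA : associative padd.
Proof.
move=> r s t; rewrite -[r]preprK -[s]preprK -[t]preprK !padd_class.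
exact/pclassP/palg_addA.
Qed.
Fact paddC : commutative padd.
Proof.
by move=> s t; rewrite -[s]preprK -[t]preprK !padd_class; exact/pclassP/palg_addC.
Qed.
Fact padd0 : left_id (pcst 0) padd.
Proof. by move=> t; rewrite -[t]preprK padd_class; exact/pclassP/palg_add0. Qed.
Fact paddN : left_inverse (pcst 0) (pmul (pcst (-1))) padd.
Proof.
move=> t; rewrite -[t]preprK pmul_class padd_class; exact/pclassP/palg_addN.
Qed.

HB.instance Definition _ := GRing.isZmodule.Build palg paddA paddC padd0 paddN.

Lemma paddE (s t : palg) : s + t = padd s t. Proof. by []. Qed.

Fact pmulA : associative pmul.
Proof.
move=> r s t; rewrite -[r]preprK -[s]preprK -[t]preprK !pmul_class.
exact/pclassP/palg_mulA.
Qed.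
Fact pmul1 : left_id (pcst 1) pmul.
Proof. by move=> t; rewrite -[t]preprK pmul_class; exact/pclassP/palg_mul1. Qed.
Fact pcstC a t : pmul (pcst a) t = pmul t (pcst a).
Proof. by rewrite -[t]preprK !pmul_class; exact/pclassP/palg_cstC. Qed.
Fact pmulr1 : right_id (pcst 1) pmul.
Proof. by move=> t; rewrite -pcstC pmul1. Qed.
Fact pmulDl : left_distributive pmul +%R.
Proof.
move=> r s t; rewrite -[r]preprK -[s]preprK -[t]preprK !paddE.
rewrite padd_class !pmul_class padd_class; exact/pclassP/palg_mulDl.
Qed.
Fact pmulDr : right_distributive pmul +%R.
Proof.
move=> r s t; rewrite -[r]preprK -[s]preprK -[t]preprK !paddE.
rewrite padd_class !pmul_class padd_class; exact/pclassP/palg_mulDr.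
Qed.

HB.instance Definition _ :=
  GRing.Zmodule_isPzRing.Build palg pmulA pmul1 pmulr1 pmulDl pmulDr.

Definition pscale a (t : palg) : palg := pcst a * t.

Fact pscaleA a b t : pscale a (pscale b t) = pscale (a * b) t.
Proof.
rewrite /pscale mulrA; congr (_ * _); rewrite [LHS]pmul_class; apply/esym/pclassP.
exact: palg_cstM.
Qed.
Fact pscale1 : left_id 1 pscale. Proof. exact: mul1r. Qed.
Fact pscaleDr : right_distributive pscale +%R.
Proof. by move=> a s t; apply: mulrDr. Qed.
Fact pscaleDl t : {morph pscale^~ t : a b / a + b}.
Proof.
move=> a b; rewrite /pscale -mulrDl; congr (_ * _); rewrite paddE padd_class.
exact/pclassP/palg_cstD.
Qed.

HB.instance Definition _ :=
  GRing.Zmodule_isLmodule.Build K palg pscaleA pscale1 pscaleDr pscaleDl.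

Lemma palg_scaleAl a (s t : palg) : a *: (s * t) = (a *: s) * t.
Proof. exact: mulrA. Qed.
Lemma palg_scaleAr a (s t : palg) : a *: (s * t) = s * (a *: t).
Proof. by rewrite /GRing.scale /= /pscale !mulrA; congr (_ * _); apply: pcstC. Qed.

Definition pgen g : palg := pclass (NGen g).

Lemma palg_mul_alg : is_alg (1 : palg) *%R.
Proof.
split; [exact: mulrA|exact: mul1r|exact: mulr1|].
split=> x a y z; first by rewrite mulrDl palg_scaleAl.
by rewrite mulrDr palg_scaleAr.
Qed.

Lemma palg_ind (P : palg -> Prop) :
    (forall g, P (pgen g)) -> P 1 -> (forall a s t, P s -> P t -> P (a *: s + t)) ->
    (forall s t, P s -> P t -> P (s * t)) ->
  forall t, P t.
Proof.
move=> Pg P1 Pl Pm t; rewrite -[t]preprK.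
elim: (prepr t) => [g|a|s ihs u ihu|s ihs u ihu].
- exact: Pg.
- have -> : pclass (NCst a) = a *: (1 : palg) + (-1) *: 0.
    by rewrite scaler0 addr0 [RHS]pmulr1.
  have P0 : P 0 by have := Pl (-1) _ _ P1 P1; rewrite scaleN1r addNr.
  by rewrite scaler0; have := Pl a _ _ P1 P0.
- by rewrite -padd_class -[pclass s]scale1r; apply: Pl.
- by rewrite -pmul_class; apply: Pm.
Qed.

Section Lift.
Variables (B : lmodType K) (one : B) (mul : B -> B -> B) (g : G -> B).

Fixpoint nc_eval (t : nc_term) : B :=
  match t with
  | NGen x => g x
  | NCst a => a *: one
  | NAdd s t => nc_eval s + nc_eval t
  | NMul s t => mul (nc_eval s) (nc_eval t)
  end.

Definition palg_lift (t : palg) : B := nc_eval (prepr t).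

Hypothesis algB : is_alg one mul.
Hypothesis relB : forall s t, rels s t -> nc_eval s = nc_eval t.

Let mulZl a x y : mul (a *: x) y = a *: mul x y.
Proof. exact: (linearZ' _ _ ((is_alg_bilin algB).1 y)). Qed.
Let mulZr a x y : mul x (a *: y) = a *: mul x y.
Proof. exact: (linearZ' _ _ ((is_alg_bilin algB).2 x)). Qed.
Let mulDl x y z : mul (x + y) z = mul x z + mul y z.
Proof. exact: (linearD' _ _ ((is_alg_bilin algB).1 z)). Qed.
Let mulDr x y z : mul z (x + y) = mul z x + mul z y.
Proof. exact: (linearD' _ _ ((is_alg_bilin algB).2 z)). Qed.

Lemma nc_eval_eq s t : palg_eq s t -> nc_eval s = nc_eval t.
Proof.
case: algB => mA m1 m1r _.
elim=> {s t} /=.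
- exact: relB.
- by [].
- by [].
- by move=> s t u _ -> _ ->.
- by move=> s s' t t' _ -> _ ->.
- by move=> s s' t t' _ -> _ ->.
- by move=> s t u; rewrite addrA.
- by move=> s t; rewrite addrC.
- by move=> s; rewrite scale0r add0r.
- by move=> s; rewrite mulZl m1 scaleN1r addNr scale0r.
- by move=> s t u; rewrite mA.
- by move=> s; rewrite mulZl m1 scale1r.
- by move=> s t u; rewrite mulDl.
- by move=> s t u; rewrite mulDr.
- by move=> a b; rewrite scalerDl.
- by move=> a b; rewrite mulZl m1 scalerA.
- by move=> a s; rewrite mulZl mulZr m1 m1r.
Qed.

Lemma palg_lift_class s : palg_lift (pclass s) = nc_eval s.
Proof. exact/nc_eval_eq/prepr_class. Qed.

Lemma palg_lift_gen x : palg_lift (pgen x) = g x.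
Proof. exact: palg_lift_class. Qed.

Lemma palg_lift_hom : is_alg_hom (1 : palg) *%R one mul palg_lift.
Proof.
split.
- move=> a s t; rewrite -[s]preprK -[t]preprK.
  rewrite [_ *: _ in LHS]pmul_class [_ + _ in LHS]padd_class !palg_lift_class /=.
  by rewrite mulZl (is_alg1l algB).
- by rewrite [LHS]palg_lift_class /= scale1r.
- move=> s t; rewrite -[s]preprK -[t]preprK.
  by rewrite [_ * _]pmul_class !palg_lift_class.
Qed.

Lemma palg_hom_ext (f f' : palg -> B) :
    is_alg_hom (1 : palg) *%R one mul f -> is_alg_hom (1 : palg) *%R one mul f' ->
  (forall x, f (pgen x) = f' (pgen x)) -> f =1 f'.
Proof.
move=> [lf f1 fM] [lf' f'1 f'M] e; elim/palg_ind => [//||a s t es et|s t es et].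
- by rewrite f1 f'1.
- by rewrite lf lf' es et.
- by rewrite fM f'M es et.
Qed.

End Lift.
End Presentation.

HB.mixin Record isHopf (K : comNzRingType) A of GRing.Algebra K A := {
  comul : A -> tensor A A;
  counit : A -> K^o;
  antipode : A -> A;
  comul_linear : linear comul;
  counit_linear : linear counit;
  antipode_linear : linear antipode;
  comul1 : comul 1 = 1 ⊗ 1;
  comulM : forall h k : A,
    comul (h * k) =
    \sum[h1 ⊗ h2 <- comul h] \sum[k1 ⊗ k2 <- comul k] (h1 * k1) ⊗ (h2 * k2);
  counit1 : counit 1 = 1;
  counitM : forall h k : A, counit (h * k) = counit h * counit k;
  comulA : forall h : A,
    \sum[h1 ⊗ k <- comul h] \sum[h2 ⊗ h3 <- comul k] h1 ⊗ (h2 ⊗ h3) =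
    \sum[k ⊗ h3 <- comul h] \sum[h1 ⊗ h2 <- comul k] h1 ⊗ (h2 ⊗ h3);
  counit_comull : forall h : A, \sum[h1 ⊗ h2 <- comul h] counit h1 *: h2 = h;
  counit_comulr : forall h : A, \sum[h1 ⊗ h2 <- comul h] counit h2 *: h1 = h;
  antipodel : forall h : A,
    \sum[h1 ⊗ h2 <- comul h] antipode h1 * h2 = counit h *: 1;
  antipoder : forall h : A,
    \sum[h1 ⊗ h2 <- comul h] h1 * antipode h2 = counit h *: 1
}.

#[short(type="hopfType")]
HB.structure Definition Hopf (K : comNzRingType) :=
  {A of isHopf K A & GRing.Algebra K A}.

Section BilinTheory.
Variable K : comNzRingType.
Implicit Types U V W : lmodType K.

Lemma linear_comp' U V W (f : U -> V) (g : V -> W) :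
  linear f -> linear g -> linear (fun u => g (f u)).
Proof. by move=> lf lg a x y /=; rewrite lf lg. Qed.

Lemma bilin_comp U V W W' (f : U -> V -> W) (g : W -> W') :
  bilin f -> linear g -> bilin (fun u v => g (f u v)).
Proof. by case=> f1 f2 lg; split=> ? a x y; rewrite (f1, f2) lg. Qed.

Lemma bilin_compl U U' V W (f : U -> V -> W) (g : U' -> U) :
  bilin f -> linear g -> bilin (fun u v => f (g u) v).
Proof. by case=> f1 f2 lg; split=> ? a x y; rewrite ?lg (f1, f2). Qed.

Lemma bilin_compr U V V' W (f : U -> V -> W) (g : V' -> V) :
  bilin f -> linear g -> bilin (fun u v => f u (g v)).
Proof. by case=> f1 f2 lg; split=> ? a x y; rewrite ?lg (f1, f2). Qed.

Lemma bilin_swap U V W (f : U -> V -> W) : bilin f -> bilin (fun v u => f u v).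
Proof. by case. Qed.

Lemma id_linear U : linear (@id U). Proof. by []. Qed.

Lemma bilin_tsum U V V' W (f : U -> V -> V' -> W) :
    (forall u, bilin (f u)) -> (forall v v', linear (fun u => f u v v')) ->
  bilin (fun u t => \sum[v ⊗ v' <- t] f u v v').
Proof.
move=> bf lf; split=> [t|u]; last exact: tsum_linear.
by move=> a x y; rewrite -tsum_comb; apply: eq_tsum => v v'; apply: lf.
Qed.

Lemma mul_bilin (A : algType K) : bilin (@GRing.mul A).
Proof.
split=> x a y z; first by rewrite mulrDl scalerAl.
by rewrite mulrDr scalerAr.
Qed.

Lemma mul_alg (A : algType K) : is_alg (1 : A) *%R.
Proof. split; [exact: mulrA|exact: mul1r|exact: mulr1|exact: mul_bilin]. Qed.

Lemma comp_hom (A B C : lmodType K) oneA mulA oneB mulB oneC mulC f g :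
    @is_alg_hom K A B oneA mulA oneB mulB f ->
    @is_alg_hom K B C oneB mulB oneC mulC g ->
  is_alg_hom oneA mulA oneC mulC (fun x => g (f x)).
Proof.
move=> [lf f1 fM] [lg g1 gM]; split; first exact: linear_comp'.
  by rewrite f1.
by move=> x y; rewrite fM gM.
Qed.

End BilinTheory.

Section TensorAlgebra.
Variables (K : comNzRingType) (A B : lmodType K).
Variables (oneA : A) (mulA : A -> A -> A) (oneB : B) (mulB : B -> B -> B).

Definition tmul (s t : tensor A B) : tensor A B :=
  \sum[a ⊗ b <- s] \sum[a' ⊗ b' <- t] mulA a a' ⊗ mulB b b'.

Hypotheses (algA : is_alg oneA mulA) (algB : is_alg oneB mulB).

Let bA := is_alg_bilin algA.
Let bB := is_alg_bilin algB.

Lemma tmul_inner_bilin a b : bilin (fun a' b' => mulA a a' ⊗ mulB b b').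
Proof.
have h := bilin_compr (bilin_compl (pure_bilin A B) (bA.2 a)) (bB.2 b).
exact: h.
Qed.

Lemma tmul_outer_bilin t :
  bilin (fun a b => \sum[a' ⊗ b' <- t] mulA a a' ⊗ mulB b b').
Proof.
split=> [b|a] c x y; rewrite -tsum_comb; apply: eq_tsum => a' b'.
  by rewrite bA.1 (pure_bilin A B).1.
by rewrite bB.1 (pure_bilin A B).2.
Qed.

Lemma tmul_pure a b a' b' : tmul (a ⊗ b) (a' ⊗ b') = mulA a a' ⊗ mulB b b'.
Proof.
rewrite /tmul tsum_pure; last exact: tmul_outer_bilin.
by rewrite tsum_pure //; exact: tmul_inner_bilin.
Qed.

Lemma tmul_bilin : bilin tmul.
Proof.
split=> [t|s]; first exact/tsum_linear/tmul_outer_bilin.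
move=> c x y; rewrite /tmul -tsum_comb; apply: eq_tsum => a b.
exact: tsum_linear (tmul_inner_bilin a b) _ _ _.
Qed.

Lemma tmul_alg : is_alg (oneA ⊗ oneB) tmul.
Proof.
have [l r] := tmul_bilin; case: algA => mA m1 m1r _; case: algB => nA n1 n1r _.
split=> //.
- move=> x y z; move: x; apply: tensor_ext => [||a b].
  + exact: l.
  + by move=> c u v; rewrite !l.
  move: y; apply: tensor_ext => [||a' b'].
  + by move=> c u v; rewrite l r.
  + by move=> c u v; rewrite r l.
  move: z; apply: tensor_ext => [||a'' b''].
  + by move=> c u v; rewrite !r.
  + by move=> c u v; rewrite r.
  by rewrite !tmul_pure mA nA.
- apply: tensor_ext => [||a b]; [exact: r|by []|].
  by rewrite tmul_pure m1 n1.
- apply: tensor_ext => [||a b]; [exact: l|by []|].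
  by rewrite tmul_pure m1r n1r.
Qed.

Lemma tensor_hom (C : lmodType K) oneC (mulC : C -> C -> C) (f : tensor A B -> C) :
    is_alg oneC mulC -> linear f -> f (oneA ⊗ oneB) = oneC ->
    (forall a b a' b',
      f (mulA a a' ⊗ mulB b b') = mulC (f (a ⊗ b)) (f (a' ⊗ b'))) ->
  is_alg_hom (oneA ⊗ oneB) tmul oneC mulC f.
Proof.
move=> algC lf f1 fM; split=> // x y; have [l r] := tmul_bilin.
have [lC rC] := is_alg_bilin algC.
move: x; apply: tensor_ext => [||a b].
- by move=> c u v; rewrite l lf.
- by move=> c u v; rewrite lf lC.
move: y; apply: tensor_ext => [||a' b'].
- by move=> c u v; rewrite r lf.
- by move=> c u v; rewrite lf rC.
by rewrite tmul_pure fM.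
Qed.

End TensorAlgebra.

(* The co-opposite Schwarzian Hopf algebra; d stands for delta_1. *)
Inductive H1S_gen := gX | gY | gD.

Section Schwarzian.
Variable K : numFieldType.

Local Notation tX := (NGen K gX).
Local Notation tY := (NGen K gY).
Local Notation tD := (NGen K gD).

Inductive H1S_rel : nc_term K H1S_gen -> nc_term K H1S_gen -> Prop :=
| H1S_rel_YX : H1S_rel (NComm tY tX) tX
| H1S_rel_XD : H1S_rel (NComm tX tD) (NMul (NCst _ 2^-1) (NMul tD tD))
| H1S_rel_YD : H1S_rel (NComm tY tD) tD.

Definition H1Scop : Type := palg H1S_rel.
HB.instance Definition _ := GRing.PzRing.on H1Scop.
HB.instance Definition _ := GRing.Lmodule.on H1Scop.

Lemma regular_alg : is_alg (1 : K^o) *%R.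
Proof. exact: (mul_alg (K^o : algType K)). Qed.

Definition H1S_counit : H1Scop -> K^o := palg_lift 1 *%R (fun=> 0).

Lemma H1S_counit_hom : is_alg_hom (1 : H1Scop) *%R (1 : K^o) *%R H1S_counit.
Proof.
apply: (palg_lift_hom (rels := H1S_rel) regular_alg) => s t.
by case=> /=; rewrite ?(mulr0, mul0r, addr0).
Qed.

Fact H1Scop_nonzero : (1 : H1Scop) != 0.
Proof.
apply/eqP => e; have [l e1 _] := H1S_counit_hom.
by move: e1; rewrite e (linear0' l) => /esym/eqP; rewrite oner_eq0.
Qed.
HB.instance Definition _ := GRing.PzSemiRing_isNonZero.Build H1Scop H1Scop_nonzero.
HB.instance Definition _ :=
  GRing.Lmodule_isLalgebra.Build K H1Scop (@palg_scaleAl _ _ H1S_rel).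
HB.instance Definition _ :=
  GRing.Lalgebra_isAlgebra.Build K H1Scop (@palg_scaleAr _ _ H1S_rel).

Definition H1S_X : H1Scop := pgen H1S_rel gX.
Definition H1S_Y : H1Scop := pgen H1S_rel gY.
Definition H1S_d : H1Scop := pgen H1S_rel gD.

Local Notation X := H1S_X.
Local Notation Y := H1S_Y.
Local Notation d := H1S_d.

Lemma H1S_eval_id s : nc_eval (1 : H1Scop) *%R (pgen H1S_rel) s = pclass H1S_rel s.
Proof.
elim: s => [x|a|s es t et|s es t et] //=.
- exact: pmulr1.
- by rewrite es et; apply: padd_class.
- by rewrite es et; apply: pmul_class.
Qed.

Lemma H1S_relE s t : H1S_rel s t ->
  nc_eval (1 : H1Scop) *%R (pgen H1S_rel) s = nc_eval (1 : H1Scop) *%R (pgen H1S_rel) t.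
Proof. by move=> r; rewrite !H1S_eval_id; apply/pclassP/palg_rel. Qed.

Lemma H1S_YX : Y * X - X * Y = X.
Proof. by have := H1S_relE H1S_rel_YX; rewrite /= scaleN1r mulN1r. Qed.
Lemma H1S_Xd : X * d - d * X = 2^-1 *: d ^+ 2.
Proof. by have := H1S_relE H1S_rel_XD; rewrite /= scaleN1r mulN1r -scalerAl mul1r. Qed.
Lemma H1S_Yd : Y * d - d * Y = d.
Proof. by have := H1S_relE H1S_rel_YD; rewrite /= scaleN1r mulN1r. Qed.

Definition H1S_comul : H1Scop -> tensor H1Scop H1Scop :=
  palg_lift (1 ⊗ 1) (tmul *%R *%R) (fun g => match g with
    | gX => X ⊗ 1 + 1 ⊗ X + Y ⊗ d
    | gY => Y ⊗ 1 + 1 ⊗ Y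
    | gD => d ⊗ 1 + 1 ⊗ d
    end).

(* An anti-morphism; S(X) is forced by S(X) + X + S(Y) d = 0. *)
Definition H1S_antipode : H1Scop -> H1Scop :=
  palg_lift 1 (fun x y => y * x) (fun g => match g with
    | gX => - X + Y * d
    | gY => - Y
    | gD => - d
    end).

Let HH := tensor H1Scop H1Scop.
Let mulH : is_alg (1 : H1Scop) *%R := mul_alg H1Scop.
Let mulHH : is_alg (1 ⊗ 1 : HH) (tmul *%R *%R) := tmul_alg mulH mulH.

Lemma opp_alg : is_alg (1 : H1Scop) (fun x y => y * x).
Proof.
split=> [x y z|x|x|]; rewrite ?mulrA ?mul1r ?mulr1 //.
by case: (mul_bilin H1Scop).
Qed.

Ltac add_ac := rewrite -?addrA; repeat first [ reflexivity
  | match goal with |- ?t + ?u = _ + ?v => refine (f_equal (GRing.add t) (_ : u = v)) end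
  | match goal with |- ?t + _ = _ => rewrite [in RHS](addrCA _ t) end
  | match goal with |- ?t + _ = _ => rewrite [in RHS](addrC _ t) end ].

Lemma H1S_comul_rel s t : H1S_rel s t ->
  let ev := nc_eval (1 ⊗ 1 : HH) (tmul *%R *%R) (fun g => match g with
    | gX => X ⊗ 1 + 1 ⊗ X + Y ⊗ d
    | gY => Y ⊗ 1 + 1 ⊗ Y
    | gD => d ⊗ 1 + 1 ⊗ d
    end) in ev s = ev t.
Proof.
have [l r] := is_alg_bilin mulHH.
have mDl x y z : tmul *%R *%R (x + y) z = tmul *%R *%R x z + tmul *%R *%R y z :> HH.
  exact: linearD' (l z).
have mDr x y z : tmul *%R *%R x (y + z) = tmul *%R *%R x y + tmul *%R *%R x z :> HH.
  exact: linearD' (r x).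
have mZl a x y : tmul *%R *%R (a *: x) y = a *: tmul *%R *%R x y :> HH.
  exact: linearZ' (l y).
have m1 : left_id (1 ⊗ 1) (tmul *%R *%R : HH -> HH -> HH) := is_alg1l mulHH.
have [pl pr] := pure_bilin H1Scop H1Scop.
have pDl x y z : (x + y) ⊗ z = x ⊗ z + y ⊗ z :> HH := linearD' _ _ (pl z).
have pDr x y z : x ⊗ (y + z) = x ⊗ y + x ⊗ z :> HH := linearD' _ _ (pr x).
have pZl a x z : (a *: x) ⊗ z = a *: (x ⊗ z) :> HH := linearZ' _ _ (pl z).
have pZr a x z : x ⊗ (a *: z) = a *: (x ⊗ z) :> HH := linearZ' _ _ (pr x).
have eYX : Y * X = X * Y + X by rewrite -{3}H1S_YX addrC subrK.
have eXd : X * d = d * X + 2^-1 *: (d * d) by rewrite -expr2 -H1S_Xd addrC subrK.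
have eYd : Y * d = d * Y + d by rewrite -{3}H1S_Yd addrC subrK.
pose M := tmul_pure mulH mulH.
case=> /=; rewrite !mZl !m1 ?scaleN1r; apply/eqP; rewrite subr_eq; apply/eqP.
- rewrite !(mDl, mDr, M, mulr1, mul1r) eYX eYd !(pDl, pDr).
  by add_ac.
- rewrite !(mDl, mDr, M, mulr1, mul1r) eXd eYd !(pDl, pDr, pZl, pZr).
  have h : d ⊗ d = 2^-1 *: (d ⊗ d) + 2^-1 *: (d ⊗ d) :> HH.
    by rewrite -scalerDl -[2^-1]mul1r -splitr scale1r.
  by rewrite [in LHS]h !scalerDr; add_ac.
- rewrite !(mDl, mDr, M, mulr1, mul1r) eYd !(pDl, pDr, pZl, pZr).
  by add_ac.
Qed.

Lemma H1S_comul_hom : is_alg_hom (1 : H1Scop) *%R (1 ⊗ 1 : HH) (tmul *%R *%R) H1S_comul.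
Proof. exact: palg_lift_hom mulHH H1S_comul_rel. Qed.

Lemma H1S_comulX : H1S_comul X = X ⊗ 1 + 1 ⊗ X + Y ⊗ d.
Proof. exact: palg_lift_gen mulHH H1S_comul_rel _. Qed.
Lemma H1S_comulY : H1S_comul Y = Y ⊗ 1 + 1 ⊗ Y.
Proof. exact: palg_lift_gen mulHH H1S_comul_rel _. Qed.
Lemma H1S_comuld : H1S_comul d = d ⊗ 1 + 1 ⊗ d.
Proof. exact: palg_lift_gen mulHH H1S_comul_rel _. Qed.

Lemma H1S_counit_gen g : H1S_counit (pgen H1S_rel g) = 0.
Proof.
apply: (palg_lift_gen (rels := H1S_rel) regular_alg) => s t.
by case=> /=; rewrite ?(mulr0, mul0r, addr0).
Qed.

Lemma H1S_antipode_rel s t : H1S_rel s t ->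
  let ev := nc_eval (1 : H1Scop) (fun x y => y * x) (fun g => match g with
    | gX => - X + Y * d
    | gY => - Y
    | gD => - d
    end) in ev s = ev t.
Proof.
pose simp := (@mulrDl H1Scop, @mulrDr H1Scop, @mulrN H1Scop, @mulNr H1Scop,
              @opprD H1Scop, @opprK H1Scop, @mulrA H1Scop, @mulrBl H1Scop, @mulrBr H1Scop).
case=> /=; rewrite -?scalerAr ?mulr1 ?scaleN1r.
- transitivity (- (Y * X - X * Y) + Y * (Y * d - d * Y)); last by rewrite H1S_YX H1S_Yd.
  by rewrite !simp; add_ac.
- transitivity (- (X * d - d * X) + (Y * d - d * Y) * d); first by rewrite !simp; add_ac.
  rewrite H1S_Xd H1S_Yd !simp expr2.
  have h : d * d = 2^-1 *: (d * d) + 2^-1 *: (d * d).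
    by rewrite -scalerDl -[2^-1]mul1r -splitr scale1r.
  by rewrite {2}h addKr.
- transitivity (- (Y * d - d * Y)); last by rewrite H1S_Yd.
  by rewrite !simp; add_ac.
Qed.

Lemma H1S_antipode_hom :
  is_alg_hom (1 : H1Scop) *%R (1 : H1Scop) (fun x y => y * x) H1S_antipode.
Proof. exact: palg_lift_hom opp_alg H1S_antipode_rel. Qed.

Lemma H1S_antipodeX : H1S_antipode X = - X + Y * d.
Proof. exact: palg_lift_gen opp_alg H1S_antipode_rel _. Qed.
Lemma H1S_antipodeY : H1S_antipode Y = - Y.
Proof. exact: palg_lift_gen opp_alg H1S_antipode_rel _. Qed.
Lemma H1S_antipoded : H1S_antipode d = - d.
Proof. exact: palg_lift_gen opp_alg H1S_antipode_rel _. Qed.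

Lemma H1S_comul_linear : linear H1S_comul.
Proof. exact: is_alg_hom_linear H1S_comul_hom. Qed.
Lemma H1S_counit_linear : linear H1S_counit.
Proof. exact: is_alg_hom_linear H1S_counit_hom. Qed.
Lemma H1S_antipode_linear : linear H1S_antipode.
Proof. exact: is_alg_hom_linear H1S_antipode_hom. Qed.
Lemma H1S_comulM h k : H1S_comul (h * k) = tmul *%R *%R (H1S_comul h) (H1S_comul k).
Proof. exact: is_alg_homM H1S_comul_hom h k. Qed.

Lemma H1S_ind (P : H1Scop -> Prop) :
    P X -> P Y -> P d -> P 1 -> (forall a s t, P s -> P t -> P (a *: s + t)) ->
    (forall s t, P s -> P t -> P (s * t)) ->
  forall t, P t.
Proof. by move=> PX PY Pd P1 Pl Pm; apply: palg_ind => // -[]. Qed.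

Lemma H1S_hom_ext (B : lmodType K) one mul (f f' : H1Scop -> B) :
    is_alg_hom (1 : H1Scop) *%R one mul f -> is_alg_hom (1 : H1Scop) *%R one mul f' ->
    f X = f' X -> f Y = f' Y -> f d = f' d ->
  f =1 f'.
Proof. by move=> hf hf' eX eY ed; apply: palg_hom_ext hf hf' _ => -[]. Qed.

Let pD1 x y z : (x + y) ⊗ z = x ⊗ z + y ⊗ z :> HH.
Proof. exact: linearD' ((pure_bilin _ _).1 z). Qed.

Lemma tsum_comulX (U : lmodType K) (f : H1Scop -> H1Scop -> U) : bilin f ->
  tsum (H1S_comul X) f = f X 1 + f 1 X + f Y d.
Proof.
move=> bf; have l := tsum_linear bf.
by rewrite H1S_comulX !(linearD' _ _ l) !tsum_pure.
Qed.
Lemma tsum_comulY (U : lmodType K) (f : H1Scop -> H1Scop -> U) : bilin f ->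
  tsum (H1S_comul Y) f = f Y 1 + f 1 Y.
Proof.
move=> bf; have l := tsum_linear bf.
by rewrite H1S_comulY !(linearD' _ _ l) !tsum_pure.
Qed.
Lemma tsum_comuld (U : lmodType K) (f : H1Scop -> H1Scop -> U) : bilin f ->
  tsum (H1S_comul d) f = f d 1 + f 1 d.
Proof.
move=> bf; have l := tsum_linear bf.
by rewrite H1S_comuld !(linearD' _ _ l) !tsum_pure.
Qed.

Let HHH := tensor H1Scop HH.
Let mul3 : HHH -> HHH -> HHH := tmul *%R (tmul *%R *%R).
Let mulHHH : is_alg (1 ⊗ (1 ⊗ 1) : HHH) mul3 := tmul_alg mulH mulHH.

Let splitl (t : HH) : HHH := \sum[h ⊗ k <- t] h ⊗ H1S_comul k.
Let assoc (u : HH) (c : H1Scop) : HHH := \sum[a ⊗ b <- u] a ⊗ (b ⊗ c).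
Let splitr (t : HH) : HHH := \sum[h ⊗ k <- t] assoc (H1S_comul h) k.

Let splitl_bilin : bilin (fun h k : H1Scop => h ⊗ H1S_comul k : HHH).
Proof. exact: bilin_compr (pure_bilin _ _) H1S_comul_linear. Qed.

Let assoc_inner c : bilin (fun a b : H1Scop => a ⊗ (b ⊗ c) : HHH).
Proof. exact: bilin_compr (pure_bilin _ _) ((pure_bilin _ _).1 c). Qed.

Let assoc_bilin : bilin assoc.
Proof.
split=> [c|u]; first exact/tsum_linear/assoc_inner.
move=> a x y; rewrite /assoc -tsum_comb; apply: eq_tsum => h k.
by rewrite (pure_bilin _ _).2 (pure_bilin _ _).2.
Qed.

Let assocM u u' c c' :
  assoc (tmul *%R *%R u u') (c * c') = mul3 (assoc u c) (assoc u' c').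
Proof.
have [l r] := is_alg_bilin mulHH; have [l3 r3] := is_alg_bilin mulHHH.
have la k := assoc_bilin.1 k.
move: u; apply: tensor_ext => [||a b].
- by move=> e x y; rewrite l la.
- by move=> e x y; rewrite la l3.
move: u'; apply: tensor_ext => [||a' b'].
- by move=> e x y; rewrite r la.
- by move=> e x y; rewrite la r3.
rewrite (tmul_pure mulH mulH) /assoc !tsum_pure //; try exact: assoc_inner.
by rewrite /mul3 (tmul_pure mulH mulHH) (tmul_pure mulH mulH).
Qed.

Let comul1' : H1S_comul 1 = 1 ⊗ 1 := is_alg_hom1 H1S_comul_hom.

Let splitr_bilin : bilin (fun h k : H1Scop => assoc (H1S_comul h) k).
Proof. exact: bilin_compl assoc_bilin H1S_comul_linear. Qed.

Let assoc_pure a b c : assoc (a ⊗ b) c = a ⊗ (b ⊗ c).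
Proof. exact: tsum_pure (assoc_inner c). Qed.

Let splitl_hom : is_alg_hom (1 ⊗ 1 : HH) (tmul *%R *%R) (1 ⊗ (1 ⊗ 1) : HHH) mul3 splitl.
Proof.
apply: (tensor_hom mulH mulH mulHHH) => [||a b a' b'].
- exact: tsum_linear splitl_bilin.
- by rewrite /splitl (tsum_pure _ _ splitl_bilin) comul1'.
- by rewrite /splitl !(tsum_pure _ _ splitl_bilin) H1S_comulM /mul3 (tmul_pure mulH mulHH).
Qed.

Let splitr_hom : is_alg_hom (1 ⊗ 1 : HH) (tmul *%R *%R) (1 ⊗ (1 ⊗ 1) : HHH) mul3 splitr.
Proof.
apply: (tensor_hom mulH mulH mulHHH) => [||a b a' b'].
- exact: tsum_linear splitr_bilin.
- by rewrite /splitr (tsum_pure _ _ splitr_bilin) comul1' assoc_pure.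
- by rewrite /splitr !(tsum_pure _ _ splitr_bilin) H1S_comulM assocM.
Qed.

Lemma H1S_comulA h :
  \sum[h1 ⊗ k <- H1S_comul h] \sum[h2 ⊗ h3 <- H1S_comul k] h1 ⊗ (h2 ⊗ h3) =
  \sum[k ⊗ h3 <- H1S_comul h] \sum[h1 ⊗ h2 <- H1S_comul k] h1 ⊗ (h2 ⊗ h3).
Proof.
transitivity (splitl (H1S_comul h)).
  apply: eq_tsum => a k.
  by rewrite -(lin_tsum _ _ ((pure_bilin _ _).2 a)) tsum_id.
rewrite -[RHS]/(splitr (H1S_comul h)); move: h.
apply: (H1S_hom_ext (comp_hom H1S_comul_hom splitl_hom)
                    (comp_hom H1S_comul_hom splitr_hom)).
- rewrite /splitl /splitr !tsum_comulX // comul1' H1S_comulX H1S_comuld H1S_comulY.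
  rewrite !(linearD' _ _ (assoc_bilin.1 _)) !assoc_pure.
  rewrite !(linearD' _ _ ((pure_bilin _ _).2 _)); add_ac.
- rewrite /splitl /splitr !tsum_comulY // comul1' H1S_comulY.
  rewrite !(linearD' _ _ (assoc_bilin.1 _)) !assoc_pure.
  rewrite !(linearD' _ _ ((pure_bilin _ _).2 _)); add_ac.
- rewrite /splitl /splitr !tsum_comuld // comul1' H1S_comuld.
  rewrite !(linearD' _ _ (assoc_bilin.1 _)) !assoc_pure.
  rewrite !(linearD' _ _ ((pure_bilin _ _).2 _)); add_ac.
Qed.

Let counit1' : H1S_counit 1 = 1 := is_alg_hom1 H1S_counit_hom.
Let counitX : H1S_counit X = 0 := H1S_counit_gen gX.
Let counitY : H1S_counit Y = 0 := H1S_counit_gen gY.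
Let counitd : H1S_counit d = 0 := H1S_counit_gen gD.
Lemma H1S_counitM h k : H1S_counit (h * k) = H1S_counit h * H1S_counit k.
Proof. exact: is_alg_homM H1S_counit_hom h k. Qed.

Let cl_bilin : bilin (fun h k : H1Scop => H1S_counit h *: k).
Proof.
split=> x a y z; last by rewrite scalerDr !scalerA mulrC.
by rewrite H1S_counit_linear scalerDl scalerA.
Qed.
Let cr_bilin : bilin (fun h k : H1Scop => H1S_counit k *: h).
Proof. exact: bilin_swap cl_bilin. Qed.

Lemma H1S_counitl h : \sum[h1 ⊗ h2 <- H1S_comul h] H1S_counit h1 *: h2 = h.
Proof.
have hom : is_alg_hom (1 ⊗ 1 : HH) (tmul *%R *%R) (1 : H1Scop) *%R
    (fun t => \sum[h1 ⊗ h2 <- t] H1S_counit h1 *: h2).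
  apply: (tensor_hom mulH mulH mulH); first exact: tsum_linear cl_bilin.
    by rewrite (tsum_pure _ _ cl_bilin) counit1' scale1r.
  move=> a b a' b'; rewrite !(tsum_pure _ _ cl_bilin) H1S_counitM.
  by rewrite -scalerAl -scalerAr scalerA.
move: h; apply: (H1S_hom_ext (comp_hom H1S_comul_hom hom) (f' := id)) => //.
- by rewrite tsum_comulX // counit1' counitX counitY !scale0r scale1r add0r addr0.
- by rewrite tsum_comulY // counit1' counitY scale0r scale1r add0r.
- by rewrite tsum_comuld // counit1' counitd scale0r scale1r add0r.
Qed.

Lemma H1S_counitr h : \sum[h1 ⊗ h2 <- H1S_comul h] H1S_counit h2 *: h1 = h.
Proof.
have hom : is_alg_hom (1 ⊗ 1 : HH) (tmul *%R *%R) (1 : H1Scop) *%R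
    (fun t => \sum[h1 ⊗ h2 <- t] H1S_counit h2 *: h1).
  apply: (tensor_hom mulH mulH mulH); first exact: tsum_linear cr_bilin.
    by rewrite (tsum_pure _ _ cr_bilin) counit1' scale1r.
  move=> a b a' b'; rewrite !(tsum_pure _ _ cr_bilin) H1S_counitM.
  by rewrite -scalerAl -scalerAr scalerA.
move: h; apply: (H1S_hom_ext (comp_hom H1S_comul_hom hom) (f' := id)) => //.
- by rewrite tsum_comulX // counit1' counitX counitd !scale0r scale1r !addr0.
- by rewrite tsum_comulY // counit1' counitY scale0r scale1r addr0.
- by rewrite tsum_comuld // counit1' counitd scale0r scale1r addr0.
Qed.

Let S1 : H1S_antipode 1 = 1 := is_alg_hom1 H1S_antipode_hom.
Let SM h k : H1S_antipode (h * k) = H1S_antipode k * H1S_antipode h.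
Proof. exact: is_alg_homM H1S_antipode_hom h k. Qed.

Let Sl_bilin : bilin (fun h k : H1Scop => H1S_antipode h * k).
Proof. exact: bilin_compl (mul_bilin _) H1S_antipode_linear. Qed.
Let Sr_bilin : bilin (fun h k : H1Scop => h * H1S_antipode k).
Proof. exact: bilin_compr (mul_bilin _) H1S_antipode_linear. Qed.

Lemma H1S_antipodel h :
  \sum[h1 ⊗ h2 <- H1S_comul h] H1S_antipode h1 * h2 = H1S_counit h *: 1.
Proof.
elim/H1S_ind: h => [||||a s t es et|s t es et].
- rewrite tsum_comulX // H1S_antipodeX S1 H1S_antipodeY counitX scale0r.
  by rewrite mulr1 mul1r mulNr [- X + _ + X]addrAC addNr add0r subrr.
- by rewrite tsum_comulY // S1 H1S_antipodeY counitY scale0r mulr1 mul1r addNr.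
- by rewrite tsum_comuld // S1 H1S_antipoded counitd scale0r mulr1 mul1r addNr.
- by rewrite comul1' (tsum_pure _ _ Sl_bilin) S1 counit1' mulr1 scale1r.
- rewrite H1S_comul_linear (tsum_linear Sl_bilin) es et H1S_counit_linear.
  by rewrite scalerDl scalerA.
have [l r] := is_alg_bilin mulHH.
have lS := tsum_linear Sl_bilin.
rewrite H1S_comulM H1S_counitM -scalerA -et; move: (H1S_comul t).
apply: tensor_ext => [||a b].
- by move=> e x y; rewrite r lS.
- by move=> e x y; rewrite lS scalerDr !scalerA mulrC.
rewrite (tsum_pure _ _ Sl_bilin) /tmul (lin_tsum _ _ lS).
transitivity (\sum[h1 ⊗ h2 <- H1S_comul s] H1S_antipode a * (H1S_antipode h1 * h2) * b).
  apply: eq_tsum => h1 h2.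
  rewrite tsum_pure ?(tsum_pure _ _ Sl_bilin) ?SM ?mulrA //.
  exact: tmul_inner_bilin mulH mulH h1 h2.
rewrite -(lin_tsum (g := fun x => H1S_antipode a * x * b)) ?es.
  by rewrite -scalerAr mulr1 -scalerAl.
by move=> e x y; rewrite mulrDr mulrDl -scalerAr -scalerAl.
Qed.

Lemma H1S_antipoder h :
  \sum[h1 ⊗ h2 <- H1S_comul h] h1 * H1S_antipode h2 = H1S_counit h *: 1.
Proof.
elim/H1S_ind: h => [||||a s t es et|s t es et].
- rewrite tsum_comulX // H1S_antipodeX S1 H1S_antipoded counitX scale0r.
  by rewrite mulr1 mul1r mulrN addrA subrr add0r subrr.
- by rewrite tsum_comulY // S1 H1S_antipodeY counitY scale0r mulr1 mul1r subrr.
- by rewrite tsum_comuld // S1 H1S_antipoded counitd scale0r mulr1 mul1r subrr.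
- by rewrite comul1' (tsum_pure _ _ Sr_bilin) S1 counit1' mulr1 scale1r.
- rewrite H1S_comul_linear (tsum_linear Sr_bilin) es et H1S_counit_linear.
  by rewrite scalerDl scalerA.
have [l r] := is_alg_bilin mulHH.
have lS := tsum_linear Sr_bilin.
rewrite H1S_comulM H1S_counitM mulrC -scalerA -es; move: (H1S_comul s).
apply: tensor_ext => [||a b].
- by move=> e x y; rewrite l lS.
- by move=> e x y; rewrite lS scalerDr !scalerA mulrC.
rewrite (tsum_pure _ _ Sr_bilin) /tmul tsum_pure; last first.
  exact: tmul_outer_bilin mulH mulH _.
rewrite (lin_tsum _ _ lS).
transitivity (\sum[h1 ⊗ h2 <- H1S_comul t] a * (h1 * H1S_antipode h2) * H1S_antipode b).
  by apply: eq_tsum => h1 h2; rewrite (tsum_pure _ _ Sr_bilin) SM !mulrA.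
rewrite -(lin_tsum (g := fun x => a * x * H1S_antipode b)) ?et.
  by rewrite -scalerAr mulr1 -scalerAl.
by move=> e x y; rewrite mulrDr mulrDl -scalerAr -scalerAl.
Qed.

HB.instance Definition _ := isHopf.Build K H1Scop
  H1S_comul_linear H1S_counit_linear H1S_antipode_linear
  comul1' H1S_comulM counit1' H1S_counitM H1S_comulA
  H1S_counitl H1S_counitr H1S_antipodel H1S_antipoder.
End Schwarzian.

Section SAYD.
Variables (K : comNzRingType) (H : hopfType K) (M : lmodType K).

Record is_right_module (act : M -> H -> M) : Prop := IsRightModule {
  right_module_bilin : bilin act;
  right_module1 : forall m, act m 1 = m;
  right_moduleM : forall m h k, act m (h * k) = act (act m h) k
}.

Record is_left_comodule (coact : M -> tensor H M) : Prop := IsLeftComodule {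
  left_comodule_linear : linear coact;
  left_comoduleA : forall m,
    \sum[h ⊗ n <- coact m] \sum[h1 ⊗ h2 <- comul h] h1 ⊗ (h2 ⊗ n) =
    \sum[h1 ⊗ n' <- coact m] \sum[h2 ⊗ n <- coact n'] h1 ⊗ (h2 ⊗ n);
  left_comodule_counit : forall m, \sum[h ⊗ n <- coact m] counit h *: n = m
}.

Record is_SAYD (act : M -> H -> M) (coact : M -> tensor H M) : Prop := IsSAYD {
  SAYD_module : is_right_module act;
  SAYD_comodule : is_left_comodule coact;
  SAYD_compat : forall m h,
    coact (act m h) =
    \sum[h1 ⊗ k <- comul h] \sum[h2 ⊗ h3 <- comul k] \sum[x ⊗ n <- coact m]
      (antipode h3 * x * h1) ⊗ act n h2;
  SAYD_stable : forall m, \sum[x ⊗ n <- coact m] act n x = m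
}.

End SAYD.

Section SchwarzianModule.
Variables (K : numFieldType) (M : lmodType K) (one RX RY RZ : M).

Local Notation X := (H1S_X K).
Local Notation Y := (H1S_Y K).
Local Notation d := (H1S_d K).

Definition is_H1S_action (act : M -> H1Scop K -> M) : Prop :=
  [/\ is_right_module act,
      [/\ act one X = 0, act one Y = one & act one d = RZ],
      [/\ act RX X = - RY, act RX Y = 2 *: RX & act RX d = 0],
      [/\ act RY X = - RZ, act RY Y = RY & act RY d = 0]
    & [/\ act RZ X = 0, act RZ Y = 0 & act RZ d = 0]].

Definition is_H1S_coaction (coact : M -> tensor (H1Scop K) M) : Prop :=
  [/\ linear coact,
      coact one = 1 ⊗ one + X ⊗ RX + Y ⊗ RY,
      coact RX = 1 ⊗ RX,
      coact RY = 1 ⊗ RY + d ⊗ RX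
    & coact RZ = 1 ⊗ RZ + d ⊗ RY + (2^-1 *: d ^+ 2) ⊗ RX].

End SchwarzianModule.

(* Main.v *)
Require Import Defs.
From HB Require Import structures.
From mathcomp Require Import all_boot all_order all_algebra.
From mathcomp Require Import boolp reals complex.
Set Implicit Arguments.
Unset Strict Implicit.
Unset Printing Implicit Defensive.
Import GRing.Theory Num.Theory.
Local Open Scope ring_scope.
Local Open Scope complex_scope.

(** Write [H] for the Schwarzian Hopf algebra and [M] for the four-dimensional
module. The anti-Yetter-Drinfeld condition has to hold for every [h] in [H],
an infinite-dimensional algebra, while both structures are given only on the
generators [X], [Y], [d] and on a basis. The bridge between the two is that the
right-hand side of the condition is itself an action: since the iterated
coproduct is multiplicative and the antipode antimultiplicative,
  (x ⊗ n) . h = S(h_3) x h_1 ⊗ n . h_2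
makes H ⊗ M a right [H]-module ([twist_module]). The condition then says that
the coaction is a morphism of right modules, and a linear map between two right
modules is a morphism as soon as it commutes with the generators
([H1S_module_map]). So the condition reduces to three generators times four
basis vectors, that is twelve identities in H ⊗ M ([coact_twistX],
[coact_twistY], [coact_twistd]); each follows by ordering monomials as
d < X < Y with the defining relations and cancelling. Coassociativity, the
counit law and stability are linear in [m], hence checked on the basis alone.

The action exists because [H] is presented by generators and relations: three
endomorphisms of [M] that satisfy the opposite relations extend to [H]
([H1S_action_exists]), and the relations between endomorphisms are read off on
the basis. It is unique by [H1S_module_map] again, applied to the identity
of [M]. The coaction exists and is unique because a linear map is determined by
arbitrary values on a basis. *)

(** * Linear maps and a basis *)

Section Basis.
Variables (K : fieldType) (M : vectType K) (n : nat) (b : n.-tuple M).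
Hypothesis basisb : basis_of fullv b.

Lemma linear_basis_ext (U : lmodType K) (f g : M -> U) :
  linear f -> linear g -> (forall i : 'I_n, f b`_i = g b`_i) -> f =1 g.
Proof.
move=> lf lg fg m; rewrite (coord_basis basisb (memvf m)).
rewrite (Defs.linear_sum _ _ lf) (Defs.linear_sum _ _ lg).
by apply: eq_bigr => i _; rewrite (linearZ' _ _ lf) (linearZ' _ _ lg) fg.
Qed.

Lemma linear_basis_exists (U : lmodType K) (u : seq U) :
  exists f : M -> U, linear f /\ forall i : 'I_n, f b`_i = u`_i.
Proof.
exists (fun m => \sum_(i < n) coord b i m *: u`_i); split=> [a x y|i].
  rewrite scaler_sumr -big_split; apply: eq_bigr => i _ /=.
  by rewrite linearP scalerDl scalerA.
rewrite (bigD1 i) //= coord_free ?(basis_free basisb) // eqxx scale1r.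
rewrite big1 ?addr0 // => j ji; rewrite coord_free ?(basis_free basisb) //.
by rewrite eq_sym (negPf ji) scale0r.
Qed.

End Basis.

Lemma basis4_ext (K : fieldType) (M : vectType K) (b0 b1 b2 b3 : M)
    (U : lmodType K) (f g : M -> U) :
    basis_of fullv [:: b0; b1; b2; b3] -> linear f -> linear g ->
    f b0 = g b0 -> f b1 = g b1 -> f b2 = g b2 -> f b3 = g b3 ->
  f =1 g.
Proof.
move=> bas lf lg e0 e1 e2 e3.
apply: (linear_basis_ext (b := [tuple b0; b1; b2; b3]) bas lf lg).
by case=> [[|[|[|[|i]]]]].
Qed.

Lemma basis4_exists (K : fieldType) (M : vectType K) (b0 b1 b2 b3 : M)
    (U : lmodType K) (u0 u1 u2 u3 : U) :
    basis_of fullv [:: b0; b1; b2; b3] ->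
  exists f : M -> U, linear f /\ [/\ f b0 = u0, f b1 = u1, f b2 = u2 & f b3 = u3].
Proof.
move=> bas.
have [f [lf fb]] :=
  linear_basis_exists (b := [tuple b0; b1; b2; b3]) bas [:: u0; u1; u2; u3].
exists f; split=> //.
by split; [have := fb 0|have := fb 1|have := fb 2%:R|have := fb 3%:R].
Qed.

Lemma lfun_of_linear (K : fieldType) (M N : vectType K) (f : M -> N) :
  linear f -> exists F : 'Hom(M, N), F =1 f.
Proof.
move=> lf; pose g : {linear M -> N} := HB.pack f (GRing.isLinear.Build K M N *:%R f lf).
by exists (linfun g) => m; rewrite lfunE.
Qed.

Lemma basis4_lfun (K : fieldType) (M N : vectType K) (b0 b1 b2 b3 : M) (u0 u1 u2 u3 : N) :
    basis_of fullv [:: b0; b1; b2; b3] ->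
  exists f : 'Hom(M, N), [/\ f b0 = u0, f b1 = u1, f b2 = u2 & f b3 = u3].
Proof.
move=> bas; have [f [lf fb]] := basis4_exists u0 u1 u2 u3 bas.
by have [F Ff] := lfun_of_linear lf; exists F; rewrite !Ff.
Qed.

(** * The twisted action on the tensor product of a Hopf algebra and a module *)

Section TwistedModule.
Variables (K : comNzRingType) (H : hopfType K) (M : lmodType K).

Let HH := tensor H H.
Let HHH := tensor H HH.
Let mulHH : is_alg (1 ⊗ 1 : HH) (tmul *%R *%R) := tmul_alg (mul_alg H) (mul_alg H).
Let mul3 : HHH -> HHH -> HHH := tmul *%R (tmul *%R *%R).
Let mulHHH : is_alg (1 ⊗ (1 ⊗ 1) : HHH) mul3 := tmul_alg (mul_alg H) mulHH.

(** The iterated coproduct, bracketed to the right. *)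
Definition comul3 (h : H) : HHH := \sum[h1 ⊗ k <- comul h] h1 ⊗ comul k.

Let comul3_bilin : bilin (fun h1 k : H => h1 ⊗ comul k : HHH).
Proof. exact: bilin_compr (pure_bilin _ _) (comul_linear (s := H)). Qed.

Lemma comul3_hom : is_alg_hom (1 : H) *%R (1 ⊗ (1 ⊗ 1) : HHH) mul3 comul3.
Proof.
have comul_hom : is_alg_hom (1 : H) *%R (1 ⊗ 1 : HH) (tmul *%R *%R) comul.
  by split; [exact: comul_linear|exact: comul1|move=> h k; exact: comulM].
apply: (comp_hom (g := fun t => \sum[h1 ⊗ k <- t] h1 ⊗ comul k) comul_hom).
apply: (tensor_hom (mul_alg H) (mul_alg H) mulHHH) => [||a b a' b'].
- exact: tsum_linear comul3_bilin.
- by rewrite tsum_pure ?comul1.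
- by rewrite !tsum_pure // comulM /mul3 (tmul_pure (mul_alg H) mulHH).
Qed.

Variable act : M -> H -> M.
Hypothesis actM : is_right_module act.
Hypothesis antipodeM : forall h k : H, antipode (h * k) = antipode k * antipode h.

(** The twisted action, with the iterated coproduct of [h] replaced by an
arbitrary tensor [T]. Trilinearity lets [twist3M] be checked on pure tensors,
where no Sweedler sums remain. *)
Definition twist3 (T : HHH) (t : tensor H M) : tensor H M :=
  \sum[a ⊗ u <- T] \sum[b ⊗ c <- u] \sum[x ⊗ n <- t]
    (antipode c * x * a) ⊗ act n b.

(** The right-hand side of the anti-Yetter-Drinfeld condition, as a function of
the value [t] of the coaction. *)
Definition twist (t : tensor H M) (h : H) : tensor H M :=
  \sum[h1 ⊗ k <- comul h] \sum[h2 ⊗ h3 <- comul k] \sum[x ⊗ n <- t]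
    (antipode h3 * x * h1) ⊗ act n h2.

Let actD := (right_module_bilin actM).1.
Let actDr := (right_module_bilin actM).2.

Let bilin_xn (a b c : H) : bilin (fun x n => (antipode c * x * a) ⊗ act n b).
Proof.
split=> [n|x] e y z.
  by rewrite mulrDr mulrDl -scalerAr -scalerAl (pure_bilin _ _).1.
by rewrite actD (pure_bilin _ _).2.
Qed.

Let bilin_bc (a : H) t : bilin (fun b c : H =>
  \sum[x ⊗ n <- t] (antipode c * x * a) ⊗ act n b).
Proof.
split=> [c|b] e y z; rewrite -tsum_comb; apply: eq_tsum => x n.
  by rewrite actDr (pure_bilin _ _).2.
by rewrite antipode_linear !mulrDl -!scalerAl (pure_bilin _ _).1.
Qed.

Let bilin_au t : bilin (fun (a : H) (u : HH) =>
  \sum[b ⊗ c <- u] \sum[x ⊗ n <- t] (antipode c * x * a) ⊗ act n b).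
Proof.
apply: (bilin_tsum (f := fun a b c => _)) => [a|b c]; first exact: bilin_bc.
move=> e y z; rewrite -tsum_comb; apply: eq_tsum => x n.
by rewrite mulrDr -scalerAr (pure_bilin _ _).1.
Qed.

Lemma twist3_bilin : bilin twist3.
Proof.
split=> [t|T]; first exact: tsum_linear (bilin_au t).
move=> e t t'; rewrite /twist3 -tsum_comb; apply: eq_tsum => a u.
by rewrite -tsum_comb; apply: eq_tsum => b c; apply: tsum_linear.
Qed.

Lemma twist3_pure (a b c x : H) n :
  twist3 (a ⊗ (b ⊗ c)) (x ⊗ n) = (antipode c * x * a) ⊗ act n b.
Proof.
rewrite /twist3 tsum_pure; last exact: bilin_au.
by rewrite tsum_pure ?tsum_pure.
Qed.

(** On pure tensors this is S(c c') x a a' = S(c') (S(c) x a) a' in the first leg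
and the module law in the second; the reversal of the antipode is what makes
the action a right one. *)
Lemma twist3M T T' t : twist3 (mul3 T T') t = twist3 T' (twist3 T t).
Proof.
have [l r] := twist3_bilin; have [ml mr] := is_alg_bilin mulHHH.
have [_ qr] := pure_bilin H HH.
move: T; apply: tensor_ext => [e u v|e u v|a u]; rewrite ?ml ?l ?r //.
move: u; apply: tensor_ext => [e u v|e u v|b c]; rewrite ?qr ?ml ?l ?r //.
move: T'; apply: tensor_ext => [e u v|e u v|a' u]; rewrite ?mr ?l ?r //.
move: u; apply: tensor_ext => [e u v|e u v|b' c']; rewrite ?qr ?mr ?l ?r //.
move: t; apply: tensor_ext => [e u v|e u v|x n]; rewrite ?l ?r //.
rewrite /mul3 (tmul_pure (mul_alg H) mulHH) (tmul_pure (mul_alg H) (mul_alg H)).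
by rewrite !twist3_pure antipodeM (right_moduleM actM) !mulrA.
Qed.

Lemma twistE t h : twist t h = twist3 (comul3 h) t.
Proof.
rewrite /comul3 (lin_tsum (g := fun T => twist3 T t)); last exact: twist3_bilin.1.
by apply: eq_tsum => h1 k; rewrite /twist3 tsum_pure; last exact: bilin_au.
Qed.

(** The twisted action is [twist3] pulled back along the algebra morphism
[comul3]. *)
Lemma twist_module : is_right_module twist.
Proof.
have [l r] := twist3_bilin; case: comul3_hom => cl c1 cM.
have S1 : antipode (1 : H) = 1.
  have := antipodel (1 : H); rewrite comul1 counit1 scale1r tsum_pure ?mulr1 //.
  exact: bilin_compl (mul_bilin H) (antipode_linear (s := H)).
split=> [|t|t h k].
- by split=> [h|t] e u v; rewrite !twistE ?cl ?l ?r.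
- rewrite twistE c1; move: t; apply: tensor_ext => // x n.
  by rewrite twist3_pure S1 mul1r mulr1 (right_module1 actM).
- by rewrite !twistE cM twist3M.
Qed.

End TwistedModule.

(** * Right modules over the Schwarzian Hopf algebra *)

(** The elements [h] whose action commutes with [f] form a subalgebra, so it is
enough that this subalgebra contains the generators. *)
Lemma H1S_module_map (K : numFieldType) (M N : lmodType K)
    (actM : M -> H1Scop K -> M) (actN : N -> H1Scop K -> N) (f : M -> N) :
    is_right_module actM -> is_right_module actN -> linear f ->
    (forall m, f (actM m (H1S_X K)) = actN (f m) (H1S_X K)) ->
    (forall m, f (actM m (H1S_Y K)) = actN (f m) (H1S_Y K)) ->
    (forall m, f (actM m (H1S_d K)) = actN (f m) (H1S_d K)) ->
  forall h m, f (actM m h) = actN (f m) h.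
Proof.
move=> [[_ lM] M1 MM] [[_ lN] N1 NM] lf fX fY fd; elim/H1S_ind => //.
- by move=> m; rewrite M1 N1.
- by move=> a s t es et m; rewrite lM lf lN es et.
- by move=> s t es et m; rewrite MM NM et es.
Qed.

(** Composition is reversed because a right action sends a product [h * k] to
the operator of [h] followed by that of [k]. *)
Lemma rev_lfun_alg (K : fieldType) (M : vectType K) :
  is_alg (\1%VF : 'End(M)) (fun f g => (g \o f)%VF).
Proof.
split=> [f g h|f|f|]; rewrite ?comp_lfunA ?comp_lfun1l ?comp_lfun1r //.
split=> f a g h /=; first by rewrite comp_lfunDr comp_lfunZr.
by rewrite comp_lfunDl comp_lfunZl.
Qed.

(** The hypotheses are the defining relations of the algebra with the order of
every product reversed, see [rev_lfun_alg]. *)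
Lemma H1S_action_exists (K : numFieldType) (M : vectType K) (FX FY Fd : 'End(M)) :
    ((FX \o FY) - (FY \o FX) = FX)%VF ->
    ((Fd \o FX) - (FX \o Fd) = 2^-1 *: (Fd \o Fd))%VF ->
    ((Fd \o FY) - (FY \o Fd) = Fd)%VF ->
  exists act : M -> H1Scop K -> M, is_right_module act /\
    [/\ act^~ (H1S_X K) =1 FX, act^~ (H1S_Y K) =1 FY & act^~ (H1S_d K) =1 Fd].
Proof.
move=> rYX rXd rYd; set alg := rev_lfun_alg M.
pose F g := match g with gX => FX | gY => FY | gD => Fd end.
have rel s t : H1S_rel s t ->
    nc_eval (\1%VF : 'End(M)) (fun f g => (g \o f)%VF) F s =
    nc_eval (\1%VF : 'End(M)) (fun f g => (g \o f)%VF) F t.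
  by case=> /=; rewrite -!comp_lfunZr !comp_lfun1r ?scaleN1r.
have [lL L1 LM] := palg_lift_hom alg rel.
exists (fun m h => palg_lift (\1%VF : 'End(M)) (fun f g => (g \o f)%VF) F h m).
split; last by split=> m; rewrite [palg_lift _ _ _ _](palg_lift_gen alg rel).
split=> [|m|m h k].
- split=> [h|m] a x y; first exact: linearP.
  by rewrite lL add_lfunE scale_lfunE.
- by rewrite L1 id_lfunE.
- by rewrite LM comp_lfunE.
Qed.

(** * The twisted action of the Schwarzian generators *)

Section SchwarzianSAYD.
Variable K : numFieldType.

Local Notation H := (H1Scop K).
Local Notation X := (H1S_X K).
Local Notation Y := (H1S_Y K).
Local Notation d := (H1S_d K).
Local Notation e := (2^-1 *: d ^+ 2).

(** Proves an equality of sums of signed atoms in an additive group: everything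
moves to the left, then the leading atom is cancelled against its opposite. *)
Ltac zmod_cancel :=
  apply/eqP; rewrite -subr_eq0 ?(opprD, opprK, oppr0, add0r, addr0) -?addrA;
  apply/eqP;
  let cancel t t' :=
    first [ rewrite (addNKr t) | rewrite (addKr t) | rewrite subrr | rewrite addNr
          | rewrite (addrCA _ t') | rewrite (addrC _ t') ] in
  repeat match goal with
    | |- 0 = 0 => reflexivity
    | |- - ?t + ?u = 0 => cancel t t
    | |- ?t + ?u = 0 => cancel t (- t)
    end.

(* Commutation rules that order monomials as d < X < Y. Working with [e] instead
   of d ^+ 2 keeps every coefficient integral. *)
Let YX : Y * X = X * Y + X. Proof. by rewrite -{3}H1S_YX addrC subrK. Qed.
Let Xd : X * d = d * X + e. Proof. by rewrite -H1S_Xd addrC subrK. Qed.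
Let Yd : Y * d = d * Y + d. Proof. by rewrite -{3}H1S_Yd addrC subrK. Qed.
Let dd : d * d = e + e.
Proof. by rewrite -scalerDl -[2^-1]mul1r -splitr scale1r expr2. Qed.
Let ed : e * d = d * e. Proof. by rewrite -scalerAl -scalerAr -exprSr -exprS. Qed.
Let Xe : X * e = e * X + d * e.
Proof.
rewrite -scalerAr expr2 mulrA Xd mulrDl -mulrA Xd mulrDr mulrA ed.
rewrite -addrA -[v in _ *: (_ + v)]mulrDr -dd !scalerDr -scalerAl -expr2.
by rewrite -scalerAr.
Qed.
Let Ye : Y * e = e * Y + (e + e).
Proof.
rewrite -scalerAr expr2 mulrA Yd mulrDl -mulrA Yd mulrDr mulrA.
by rewrite -addrA !scalerDr -scalerAl -expr2.
Qed.

Variable M : lmodType K.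
Let pD1 (x y : H) (z : M) : (x + y) ⊗ z = x ⊗ z + y ⊗ z.
Proof. exact: linearD' ((pure_bilin _ _).1 z). Qed.
Let pD2 (x : H) (y z : M) : x ⊗ (y + z) = x ⊗ y + x ⊗ z.
Proof. exact: linearD' ((pure_bilin _ _).2 x). Qed.
Let p01 (z : M) : (0 : H) ⊗ z = 0.
Proof. exact: linear0' ((pure_bilin _ _).1 z). Qed.
Let p02 (x : H) : x ⊗ (0 : M) = 0.
Proof. exact: linear0' ((pure_bilin _ _).2 x). Qed.
Let pN1 (x : H) (z : M) : (- x) ⊗ z = - (x ⊗ z).
Proof. by rewrite -!scaleN1r (linearZ' _ _ ((pure_bilin _ _).1 z)). Qed.
Let pN2 (x : H) (z : M) : x ⊗ (- z) = - (x ⊗ z).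
Proof. by rewrite -!scaleN1r (linearZ' _ _ ((pure_bilin _ _).2 x)). Qed.
Let pE := (pD1, pD2, p01, p02, pN1, pN2).

Section TwistGen.
Variable act : M -> H -> M.
Hypothesis actM : is_right_module act.

Let comul3_bilin : bilin (fun h1 k : H => h1 ⊗ comul k : tensor H (tensor H H)).
Proof. exact: bilin_compr (pure_bilin _ _) (@H1S_comul_linear K). Qed.
Let qD (x : H) (u v : tensor H H) : x ⊗ (u + v) = x ⊗ u + x ⊗ v.
Proof. exact: linearD' ((pure_bilin _ _).2 x). Qed.
Let comulY : comul Y = Y ⊗ 1 + 1 ⊗ Y. Proof. exact: H1S_comulY. Qed.
Let comuld : comul d = d ⊗ 1 + 1 ⊗ d. Proof. exact: H1S_comuld. Qed.
Let comulX : comul X = X ⊗ 1 + 1 ⊗ X + Y ⊗ d. Proof. exact: H1S_comulX. Qed.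
Let comulh1 : comul (1 : H) = 1 ⊗ 1. Proof. exact: comul1. Qed.
Let S1 : antipode (1 : H) = 1. Proof. exact: is_alg_hom1 (@H1S_antipode_hom K). Qed.
Let SX : antipode X = - X + Y * d. Proof. exact: H1S_antipodeX. Qed.
Let SY : antipode Y = - Y. Proof. exact: H1S_antipodeY. Qed.
Let Sd : antipode d = - d. Proof. exact: H1S_antipoded. Qed.

Let tD T T' t : twist3 act (T + T') t = twist3 act T t + twist3 act T' t.
Proof. exact: linearD' ((twist3_bilin actM).1 t). Qed.

(** For a primitive [h] the twisted action is a commutator in the first leg plus
the action in the second. *)
Lemma twistY x n : twist act (x ⊗ n) Y = (x * Y - Y * x) ⊗ n + x ⊗ act n Y.
Proof.
rewrite twistE // /comul3 [v in twist3 _ v](tsum_comulY comul3_bilin).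
rewrite comulh1 comulY qD !tD !twist3_pure // S1 SY !(mul1r, mulr1, mulNr).
by rewrite !(right_module1 actM) pD1 [RHS]addrAC addrA.
Qed.

Lemma twistd x n : twist act (x ⊗ n) d = (x * d - d * x) ⊗ n + x ⊗ act n d.
Proof.
rewrite twistE // /comul3 [v in twist3 _ v](tsum_comuld comul3_bilin).
rewrite comulh1 comuld qD !tD !twist3_pure // S1 Sd !(mul1r, mulr1, mulNr).
by rewrite !(right_module1 actM) pD1 [RHS]addrAC addrA.
Qed.

(** The part of the twisted action of [X] that leaves the [M]-leg alone: the
terms of the iterated coproduct of [X] whose middle factor is 1. *)
Definition twistX_coef (x : H) : H := x * X - X * x + (Y * d * x - d * x * Y).

Lemma twistX x n : twist act (x ⊗ n) X =
  twistX_coef x ⊗ n + x ⊗ act n X - (d * x) ⊗ act n Y + (x * Y) ⊗ act n d.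
Proof.
rewrite twistE // /comul3 [v in twist3 _ v](tsum_comulX comul3_bilin).
rewrite comulh1 comuld comulX !qD !tD !twist3_pure // S1 SX Sd.
rewrite !(mul1r, mulr1, mulNr, mulrDl) !(right_module1 actM) /twistX_coef !pE.
zmod_cancel.
Qed.

End TwistGen.

(* The values at the five elements of [H] that occur in the coaction. *)
Lemma twistX_coef1 : twistX_coef 1 = d.
Proof. by rewrite /twistX_coef !(mulr1, mul1r) subrr add0r Yd addrAC subrr add0r. Qed.
Lemma twistX_coefX : twistX_coef X = d * X + d * X.
Proof.
rewrite /twistX_coef subrr add0r Yd mulrDl -!mulrA YX mulrDr; zmod_cancel.
Qed.
Lemma twistX_coefY : twistX_coef Y = X + d * Y.
Proof. rewrite /twistX_coef YX Yd mulrDl; zmod_cancel. Qed.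
Lemma twistX_coefd : twistX_coef d = e + (e + e).
Proof.
rewrite /twistX_coef Xd Yd mulrDl -!mulrA Yd mulrDr dd; zmod_cancel.
Qed.
Lemma twistX_coefe : twistX_coef e = d * e + d * e.
Proof.
rewrite /twistX_coef Xe Yd mulrDl -(mulrA d Y) Ye !mulrDr (mulrA d e Y); zmod_cancel.
Qed.

(** * The four-dimensional module *)

Section OnBasis.
Variables (one RX RY RZ : M) (act : M -> H -> M) (coact : M -> tensor H M).
(* All that is used of the basis is that linear maps agreeing on it are equal. *)
Hypothesis spanM : forall (U : lmodType K) (f g : M -> U), linear f -> linear g ->
  f one = g one -> f RX = g RX -> f RY = g RY -> f RZ = g RZ -> f =1 g.
Hypothesis actP : is_H1S_action one RX RY RZ act.
Hypothesis coactP : is_H1S_coaction one RX RY RZ coact.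

Let coactl : linear coact. Proof. by case: coactP. Qed.
Let actM : is_right_module act. Proof. by case: actP. Qed.
Let actl h : linear (act^~ h). Proof. exact: (right_module_bilin actM).1. Qed.
Let actr m : linear (act m). Proof. exact: (right_module_bilin actM).2. Qed.
Let act0 h : act 0 h = 0. Proof. exact: linear0' (actl h). Qed.

Let tsum_coact1 (U : lmodType K) (f : H -> M -> U) : bilin f ->
  tsum (coact one) f = f 1 one + f X RX + f Y RY.
Proof.
case: coactP => _ -> _ _ _ bf; have l := tsum_linear bf.
by rewrite !(linearD' _ _ l) !tsum_pure.
Qed.
Let tsum_coactX (U : lmodType K) (f : H -> M -> U) : bilin f ->
  tsum (coact RX) f = f 1 RX.
Proof. by case: coactP => _ _ -> _ _ bf; rewrite tsum_pure. Qed.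
Let tsum_coactY (U : lmodType K) (f : H -> M -> U) : bilin f ->
  tsum (coact RY) f = f 1 RY + f d RX.
Proof.
case: coactP => _ _ _ -> _ bf; have l := tsum_linear bf.
by rewrite !(linearD' _ _ l) !tsum_pure.
Qed.
Let tsum_coactZ (U : lmodType K) (f : H -> M -> U) : bilin f ->
  tsum (coact RZ) f = f 1 RZ + f d RY + f e RX.
Proof.
case: coactP => _ _ _ _ -> bf; have l := tsum_linear bf.
by rewrite !(linearD' _ _ l) !tsum_pure.
Qed.
Let tsum_coact := (tsum_coact1, tsum_coactX, tsum_coactY, tsum_coactZ).

Let tsum_comul1 (U : lmodType K) (f : H -> H -> U) : bilin f ->
  tsum (comul (1 : H)) f = f 1 1.
Proof. by move=> bf; rewrite comul1 tsum_pure. Qed.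

(** The cross terms of the square of the coproduct of [d] coincide, which
cancels the 1/2 in [e]. *)
Lemma tsum_comule (U : lmodType K) (f : H -> H -> U) : bilin f ->
  tsum (comul e) f = f e 1 + f d d + f 1 e.
Proof.
move=> bf; have l := tsum_linear bf.
have E : comul (d ^+ 2) = d ^+ 2 ⊗ 1 + 2 *: (d ⊗ d) + 1 ⊗ d ^+ 2.
  have alg := tmul_alg (mul_alg H) (mul_alg H).
  have [ml mr] := is_alg_bilin alg.
  rewrite expr2 [LHS](is_alg_homM (@H1S_comul_hom K)) H1S_comuld.
  rewrite (linearD' _ _ (ml _)) !(linearD' _ _ (mr _)).
  rewrite !(tmul_pure (mul_alg H) (mul_alg H)) !mulr1 !mul1r scaler_nat mulr2n.
  by rewrite !addrA.
have -> : comul e = 2^-1 *: comul (d ^+ 2) by exact: linearZ' (@H1S_comul_linear K).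
rewrite E (linearZ' _ _ l) !(linearD' _ _ l) (linearZ' _ _ l) !tsum_pure //.
rewrite !scalerDr scalerA mulVf ?pnatr_eq0 // scale1r.
by rewrite -(linearZ' _ _ (bf.1 _)) -(linearZ' _ _ (bf.2 _)).
Qed.

Let tsum_comulX' (U : lmodType K) (f : H -> H -> U) : bilin f ->
  tsum (comul X) f = f X 1 + f 1 X + f Y d.
Proof. exact: tsum_comulX. Qed.
Let tsum_comulY' (U : lmodType K) (f : H -> H -> U) : bilin f ->
  tsum (comul Y) f = f Y 1 + f 1 Y.
Proof. exact: tsum_comulY. Qed.
Let tsum_comuld' (U : lmodType K) (f : H -> H -> U) : bilin f ->
  tsum (comul d) f = f d 1 + f 1 d.
Proof. exact: tsum_comuld. Qed.

Lemma coact_comodule : is_left_comodule coact.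
Proof.
have bHHM (n : M) : bilin (fun h1 h2 : H => h1 ⊗ (h2 ⊗ n) : tensor H (tensor H M)).
  exact: bilin_compr (pure_bilin _ _) ((pure_bilin _ _).1 n).
have bHM (h1 : H) : bilin (fun (h2 : H) (n : M) => h1 ⊗ (h2 ⊗ n)).
  exact: bilin_comp (pure_bilin _ _) ((pure_bilin _ _).2 h1).
split=> // m.
- have bl : bilin (fun (h : H) (n : M) => \sum[h1 ⊗ h2 <- comul h] h1 ⊗ (h2 ⊗ n)).
    apply: (bilin_compl (f := fun u n => \sum[h1 ⊗ h2 <- u] h1 ⊗ (h2 ⊗ n)));
      last exact: H1S_comul_linear.
    apply: bilin_swap; apply: (bilin_tsum (f := fun n h1 h2 => _)) => // h1 h2.
    by move=> a x y; rewrite !(pure_bilin _ _).2.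
  have br : bilin (fun (h1 : H) (n' : M) =>
      \sum[h2 ⊗ n <- coact n'] h1 ⊗ (h2 ⊗ n)).
    apply: (bilin_compr (f := fun h1 t => \sum[h2 ⊗ n <- t] h1 ⊗ (h2 ⊗ n))) => //.
    apply: (bilin_tsum (f := fun h1 h2 n => _)) => // h2 n.
    exact: (pure_bilin _ _).1.
  move: m; apply: spanM; [exact: linear_comp' coactl (tsum_linear bl)
    |exact: linear_comp' coactl (tsum_linear br)|..];
  rewrite !tsum_coact // ?tsum_comul1 //;
  rewrite ?(tsum_comulX', tsum_comulY', tsum_comuld', tsum_comule) //;
  zmod_cancel.
- have bf : bilin (fun (h : H) (n : M) => counit h *: n).
    split=> x a y z; last by rewrite scalerDr !scalerA mulrC.
    by rewrite [counit _]H1S_counit_linear scalerDl scalerA.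
  have counite : counit e = 0 :> K^o.
    rewrite [LHS](linearZ' _ _ (@H1S_counit_linear K)) expr2 (H1S_counitM d d).
    by rewrite H1S_counit_gen mulr0 scaler0.
  have [kX kY kd] : [/\ counit X = 0 :> K^o, counit Y = 0 :> K^o & counit d = 0 :> K^o].
    by split; exact: H1S_counit_gen.
  move: m; apply: spanM; [exact: (linear_comp' coactl (tsum_linear bf))|by []|..];
  by rewrite tsum_coact // counit1 ?(kX, kY, kd, counite) scale1r ?scale0r ?addr0.
Qed.

Let twist_linear h : linear (fun t => twist act t h).
Proof.
have antipodeM := is_alg_homM (@H1S_antipode_hom K).
exact: (right_module_bilin (twist_module actM antipodeM)).1.
Qed.
Let twistD h t t' : twist act (t + t') h = twist act t h + twist act t' h.
Proof. exact: linearD' (twist_linear h). Qed.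

Lemma coact_twistY m : coact (act m Y) = twist act (coact m) Y.
Proof.
have [_ [oX oY od] [xX xY xd] [yX yY yd] [zX zY zd]] := actP.
have [_ c1 cX cY cZ] := coactP.
move: m; apply: spanM; [exact: linear_comp' (actl Y) coactl
  |exact: linear_comp' coactl (twist_linear Y)|..].
- rewrite oY c1 !twistD !(twistY actM) oY xY yY scaler_nat mulr2n YX.
  rewrite !(mulr1, mul1r) !pE; zmod_cancel.
- rewrite xY (linearZ' _ _ coactl) cX (twistY actM) xY !scaler_nat !mulr2n.
  rewrite !(mulr1, mul1r) !pE; zmod_cancel.
- rewrite yY cY twistD !(twistY actM) xY yY scaler_nat mulr2n Yd.
  rewrite !(mulr1, mul1r) !pE; zmod_cancel.
- rewrite zY (linear0' coactl) cZ !twistD !(twistY actM) xY yY zY scaler_nat mulr2n Yd Ye.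
  rewrite !(mulr1, mul1r) !pE; zmod_cancel.
Qed.

Lemma coact_twistd m : coact (act m d) = twist act (coact m) d.
Proof.
have [_ [oX oY od] [xX xY xd] [yX yY yd] [zX zY zd]] := actP.
have [_ c1 cX cY cZ] := coactP.
move: m; apply: spanM; [exact: linear_comp' (actl _) coactl
  |exact: linear_comp' coactl (twist_linear d)|..].
- rewrite od c1 cZ !twistD !(twistd actM) od xd yd Xd Yd.
  rewrite !(mulr1, mul1r) !pE; zmod_cancel.
- rewrite xd (linear0' coactl) cX (twistd actM) xd.
  rewrite !(mulr1, mul1r) !pE; zmod_cancel.
- rewrite yd (linear0' coactl) cY twistD !(twistd actM) xd yd.
  rewrite !(mulr1, mul1r) !pE; zmod_cancel.
- rewrite zd (linear0' coactl) cZ !twistD !(twistd actM) xd yd zd ed.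
  rewrite !(mulr1, mul1r) !pE; zmod_cancel.
Qed.

Let coefE := (twistX_coef1, twistX_coefX, twistX_coefY, twistX_coefd, twistX_coefe).

Lemma coact_twistX m : coact (act m X) = twist act (coact m) X.
Proof.
have [_ [oX oY od] [xX xY xd] [yX yY yd] [zX zY zd]] := actP.
have [_ c1 cX cY cZ] := coactP.
have cN u : coact (- u) = - coact u by rewrite -!scaleN1r (linearZ' _ _ coactl).
move: m; apply: spanM; [exact: linear_comp' (actl _) coactl
  |exact: linear_comp' coactl (twist_linear X)|..].
- rewrite oX (linear0' coactl) c1 !twistD !(twistX actM) !coefE.
  rewrite oX oY od xX xY xd yX yY yd scaler_nat mulr2n !(mulr1, mul1r) !pE; zmod_cancel.
- rewrite xX cN cY cX !(twistX actM) !coefE.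
  rewrite xX xY xd scaler_nat mulr2n !(mulr1, mul1r) !pE; zmod_cancel.
- rewrite yX cN cZ cY !twistD !(twistX actM) !coefE.
  rewrite xX xY xd yX yY yd scaler_nat mulr2n !(mulr1, mul1r) dd !pE; zmod_cancel.
- rewrite zX (linear0' coactl) cZ !twistD !(twistX actM) !coefE.
  rewrite xX xY xd yX yY yd zX zY zd scaler_nat mulr2n !(mulr1, mul1r) dd !pE; zmod_cancel.
Qed.

Lemma coact_stable m : \sum[x ⊗ n <- coact m] act n x = m.
Proof.
have [_ [oX oY od] [xX xY xd] [yX yY yd] [zX zY zd]] := actP.
have bf : bilin (fun (x : H) n => act n x) by exact: bilin_swap (right_module_bilin actM).
move: m; apply: spanM; [exact: linear_comp' coactl (tsum_linear bf)|by []|..];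
  rewrite tsum_coact // !(right_module1 actM) //.
- by rewrite xX yY addrNK.
- by rewrite xd addr0.
- by rewrite yd (linearZ' _ _ (actr _)) expr2 (right_moduleM actM) xd act0 scaler0 !addr0.
Qed.

End OnBasis.
End SchwarzianSAYD.

Theorem proposition5p1 (R : realType) (M : vectType R[i]) (one RX RY RZ : M)
    (basisM : basis_of fullv [:: one; RX; RY; RZ]) :
  [/\ exists! act : M -> H1Scop R[i] -> M, is_H1S_action one RX RY RZ act,
      exists! coact : M -> tensor (H1Scop R[i]) M,
        is_H1S_coaction one RX RY RZ coact
    & forall act coact,
        is_H1S_action one RX RY RZ act ->
        is_H1S_coaction one RX RY RZ coact ->
        is_SAYD act coact].
Proof.
have ext (U : lmodType R[i]) (f g : M -> U) : linear f -> linear g ->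
    f one = g one -> f RX = g RX -> f RY = g RY -> f RZ = g RZ -> f =1 g.
  exact: basis4_ext.
split.
- have [FX [oX xX yX zX]] := basis4_lfun 0 (- RY) (- RZ) 0 basisM.
  have [FY [oY xY yY zY]] := basis4_lfun one (2 *: RX) RY 0 basisM.
  have [Fd [od xd yd zd]] := basis4_lfun RZ 0 0 0 basisM.
  have vE := (oX, xX, yX, zX, oY, xY, yY, zY, od, xd, yd, zd).
  have lfunE := (add_lfunE, opp_lfunE, comp_lfunE, scale_lfunE).
  have lext (F G : 'End(M)) : F one = G one -> F RX = G RX -> F RY = G RY ->
      F RZ = G RZ -> F = G.
    by move=> *; apply/lfunP/ext => //; exact: linearP.
  have [|||act [actM [actX actY actd]]] := @H1S_action_exists _ M FX FY Fd.
  + apply: lext; rewrite !lfunE !vE ?raddf0 ?linearN ?linearZ /= ?vE;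
      rewrite ?(scaler0, addr0, sub0r, subr0, oppr0, opprK) //.
    by rewrite scaler_nat mulr2n addrNK.
  + by apply: lext; rewrite !lfunE !vE ?raddf0 ?linearN ?linearZ /= ?vE;
      rewrite ?(scaler0, addr0, sub0r, subr0, oppr0, opprK).
  + by apply: lext; rewrite !lfunE !vE ?raddf0 ?linearN ?linearZ /= ?vE;
      rewrite ?(scaler0, addr0, sub0r, subr0, oppr0, opprK).
  have actP : is_H1S_action one RX RY RZ act.
    by split=> //; split; rewrite ?(actX, actY, actd) !vE.
  exists act; split=> // act' [act'M [oX' oY' od'] [xX' xY' xd'] [yX' yY' yd']
    [zX' zY' zd']].
  have [[l _] _ _] := actM; have [[l' _] _ _] := act'M.
  have idl : linear (@id M) by [].
  apply: funext => m; apply: funext => h; move: h m.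
  apply: (H1S_module_map actM act'M idl); apply: ext => //;
    by rewrite ?(actX, actY, actd) !vE.
- have [coact [lc [c0 c1 c2 c3]]] := basis4_exists
    (1 ⊗ one + H1S_X _ ⊗ RX + H1S_Y _ ⊗ RY) (1 ⊗ RX) (1 ⊗ RY + H1S_d _ ⊗ RX)
    (1 ⊗ RZ + H1S_d _ ⊗ RY + (2^-1 *: H1S_d _ ^+ 2) ⊗ RX) basisM.
  exists coact; split=> [//|coact' [lc' c0' c1' c2' c3']].
  by apply: funext; apply: ext; rewrite // ?(c0, c1, c2, c3) ?(c0', c1', c2', c3').
- move=> act coact actP coactP; have [actM _ _ _ _] := actP.
  split=> [//||m h|m].
  + exact: (coact_comodule ext coactP).
  + have SM := is_alg_homM (@H1S_antipode_hom R[i]).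
    apply: (H1S_module_map actM (twist_module actM SM)).
    * by case: coactP.
    * exact: coact_twistX ext actP coactP.
    * exact: coact_twistY ext actP coactP.
    * exact: coact_twistd ext actP coactP.
  + exact: coact_stable ext actP coactP m.
Qed.
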